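(* Let $n\ge1$ be an integer. For $\lambda=(\lambda_1,\dots,\lambda_n)\in\mathrm{int}(E_n)$ and $a=(a_1,\dots,a_{n+1})\in(0,\infty)^{n+1}$ set $$\mathcal{L}_\lambda(a):=\int_{E_n}\prod_{i=1}^{n+1}a_i^{t_i}\,d\mu_\lambda(t),\qquad \mathbb{L}_\lambda(a):=\left(\int_{E_n}\Big(\sum_{i=1}^{n+1}t_ia_i\Big)^{-1}d\mu_\lambda(t)\right)^{-1}.$$ Then $(\mathcal{L}_\lambda)_\lambda$ and $(\mathbb{L}_\lambda)_\lambda$ are weighted multivariate means (in the sense given in the context).
   Context: $E_n:=\{(t_1,\dots,t_n)\in\mathbb{R}^n: t_i\ge 0\ (i=1,\dots,n),\ \sum_{i=1}^n t_i\le 1\}$, and $\mathrm{int}(E_n)=\{(t_1,\dots,t_n): t_i>0\ (i=1,\dots,n),\ \sum_{i=1}^n t_i<1\}$. For $t\in E_n$, $t_{n+1}:=1-\sum_{i=1}^n t_i$; for $\lambda\in E_n$, $\lambda_{n+1}:=1-\sum_{i=1}^n\lambda_i$; $dt:=dt_1\cdots dt_n$ is Lebesgue measure. For $\lambda\in\mathrm{int}(E_n)$, $\mu_\lambda$ is the probability measure on $E_n$ given by $$d\mu_\lambda(t):=\frac{\sum_{i=1}^n\alpha_i^{-1}}{B_n(\alpha_1^{-1},\dots,\alpha_n^{-1})}\prod_{i=1}^n t_i^{\alpha_i^{-1}-1}\,dt,\qquad \alpha_i:=\frac{\lambda_{n+1}}{\lambda_i},$$ where $B_n(x_1,\dots,x_n)=\prod_{i=1}^n\Gamma(x_i)\big/\Gamma(\sum_{i=1}^n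 x_i)$ is the multivariate beta function (so $B_1=1$). Let $(e_1,\dots,e_n)$ be the canonical basis of $\mathbb{R}^n$, $\mathbf{0}$ the zero vector of $\mathbb{R}^n$, and $e:=\frac1{n+1}(1,\dots,1)\in\mathbb{R}^n$. A family of maps $m_\lambda:(0,\infty)^{n+1}\to(0,\infty)$, $\lambda\in\mathrm{int}(E_n)$, is a weighted multivariate mean if: (i) for every $\lambda$ and every $a\in(0,\infty)^{n+1}$, $\min(a_1,\dots,a_{n+1})\le m_\lambda(a)\le\max(a_1,\dots,a_{n+1})$; (ii) for every $a$, $m_{e_i}(a)=a_i$ for $i=1,\dots,n$ and $m_{\mathbf{0}}(a)=a_{n+1}$, where $m_{e_i}(a)$ and $m_{\mathbf 0}(a)$ are understood as the limits of $m_\lambda(a)$ as $\lambda\to e_i$, respectively $\lambda\to\mathbf{0}$, with $\lambda\in\mathrm{int}(E_n)$; (iii) $m_e(a_1,\dots,a_{n+1})$ is symmetric in $a_1,\dots,a_{n+1}$; (iv) for every $\lambda$, the first partial derivatives of $a\mapsto m_\lambda(a)$ exist at $(1,\dots,1)\in\mathbb{R}^{n+1}$ and $\frac{\partial m_\lambda}{\partial a_i}(1,\dots,1)=\lambda_i$ for all $i=1,\dots,n+1$. *)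

(* Defs.v *)
From HB Require Import structures.
From mathcomp Require Import all_boot all_order all_algebra all_fingroup.
From mathcomp Require Import all_classical all_reals all_analysis.
From mathcomp Require Import measurable_realfun.

Set Implicit Arguments.
Unset Strict Implicit.
Unset Printing Implicit Defensive.

Import Order.TTheory GRing.Theory Num.Theory.
Import numFieldNormedType.Exports.

Local Open Scope classical_set_scope.
Local Open Scope ring_scope.

(* n.-tuple (measurableTypeR R) carries the product sigma-algebra of the Borel
   sets of R; it is the copy of R^n used for integration, whereas 'rV[R]_n is
   the copy used wherever the topology of R^n matters. *)
Section lebesgue_measure_cons.
Context (R : realType) (n : nat).
Notation T := (measurableTypeR R).
Variable m : {sigma_finite_measure set (n.-tuple T) -> \bar R}.

Definition tuple_cons (p : T * n.-tuple T) : n.+1.-tuple T :=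
  [tuple of p.1 :: p.2].

Lemma measurable_tuple_cons : measurable_fun [set: T * n.-tuple T] tuple_cons.
Proof. exact: (measurable_cons measurable_fst measurable_snd). Qed.

Definition lebesgue_cons : set (n.+1.-tuple T) -> \bar R :=
  pushforward (product_measure1 (@lebesgue_measure R) m) tuple_cons.

Let lc0 : lebesgue_cons set0 = 0%E.
Proof. by rewrite /lebesgue_cons /pushforward preimage_set0 measure0. Qed.

Let lc_ge0 A : (0 <= lebesgue_cons A)%E.
Proof. by apply: integral_ge0 => x _; exact: measure_ge0. Qed.

Let lc_sigma_additive : semi_sigma_additive lebesgue_cons.
Proof.
move=> F mF tF mUF; rewrite /lebesgue_cons /pushforward preimage_bigcup.
apply: measure_semi_sigma_additive.
- by move=> k; rewrite -[X in measurable X]setTI; exact: measurable_tuple_cons.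
- apply/trivIsetP => /= i j _ _ ij; rewrite -preimage_setI.
  by move/trivIsetP : tF => /(_ _ _ _ _ ij) ->//; rewrite preimage_set0.
- rewrite -preimage_bigcup -[X in measurable X]setTI.
  exact: measurable_tuple_cons.
Qed.

HB.instance Definition _ :=
  isMeasure.Build _ _ _ lebesgue_cons lc0 lc_ge0 lc_sigma_additive.

Lemma measurable_tuple_uncons :
  measurable_fun [set: n.+1.-tuple T]
    (fun t => (thead t, [tuple of behead t]) : T * n.-tuple T).
Proof.
apply/measurable_fun_pairP; split; last exact: measurable_behead.
exact: measurable_tnth.
Qed.

Lemma tuple_consK (p : T * n.-tuple T) :
  (thead (tuple_cons p), [tuple of behead (tuple_cons p)]) = p.
Proof. by case: p => x t /=; congr pair; apply/val_inj. Qed.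

Let lc_sigma_finite : sigma_finite setT lebesgue_cons.
Proof.
have /sigma_finiteP[F [TF ndF Foo]] := sigma_finiteT (@lebesgue_measure R).
have /sigma_finiteP[G [TG ndG Goo]] := sigma_finiteT m.
exists (fun k => (fun t : n.+1.-tuple T =>
  (thead t, [tuple of behead t]) : T * n.-tuple T) @^-1` (F k `*` G k)).
  rewrite -preimage_bigcup (_ : \bigcup_i _ = setT) ?preimage_setT//.
  apply/seteqP; split=> // -[x y] _.
  have [i _ Fix] : (\bigcup_i F i) x by rewrite -TF.
  have [j _ Gjy] : (\bigcup_j G j) y by rewrite -TG.
  exists (maxn i j) => //; split => /=.
  - by move: x Fix; exact/subsetPset/ndF/leq_maxl.
  - by move: y Gjy; exact/subsetPset/ndG/leq_maxr.
move=> k; have [mF Fk] := Foo k; have [mG Gk] := Goo k.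
have mFG : measurable (F k `*` G k) by exact: measurableX.
split.
  by rewrite -[X in measurable X]setTI; exact: measurable_tuple_uncons.
rewrite /lebesgue_cons /pushforward -comp_preimage.
rewrite (_ : _ \o _ = id) ?preimage_id//; last first.
  by apply/funext => p; exact: tuple_consK.
by rewrite product_measure1E// lte_mul_pinfty// ge0_fin_numE.
Qed.

HB.instance Definition _ :=
  Measure_isSigmaFinite.Build _ _ _ lebesgue_cons lc_sigma_finite.

End lebesgue_measure_cons.

(* The n-fold product of lebesgue_measure: see lebesgue_tuple_box. *)
Fixpoint lebesgue_tuple (R : realType) (n : nat) :
    {sigma_finite_measure set (n.-tuple (measurableTypeR R)) -> \bar R} :=
  match n with
  | 0 => dirac ([tuple] : 0.-tuple (measurableTypeR R))
  | k.+1 => lebesgue_cons (lebesgue_tuple R k)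
  end.

Lemma lebesgue_tuple_box (R : realType) (n : nat)
    (A : 'I_n -> set (measurableTypeR R)) : (forall i, measurable (A i)) ->
  lebesgue_tuple R n [set t | forall i, A i (tnth t i)] =
    (\prod_(i < n) lebesgue_measure (A i))%E.
Proof.
elim: n A => [|n IHn] A mA.
  rewrite big_ord0 /= diracE mem_set//.
  by case.
rewrite big_ord_recl -IHn// -product_measure1E//; last first.
  rewrite (_ : [set t | _] = \bigcap_(i in [set: 'I_n])
    ((fun t : n.-tuple (measurableTypeR R) => tnth t i)
       @^-1` A (lift ord0 i))).
    apply: fin_bigcap_measurable => // i _.
    by rewrite -[X in measurable X]setTI; exact: measurable_tnth.
  by apply/seteqP; split=> t /= tA i => [_|]; exact: tA.
rewrite /= /lebesgue_cons /pushforward; congr (product_measure1 _ _ _).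
apply/seteqP; split=> -[x t] /= => [tA|[xA tA] i].
  split; first exact: (tA ord0).
  by move=> i; have := tA (lift ord0 i); rewrite tnthS.
case: (unliftP ord0 i) => [j ->|->//].
by rewrite tnthS.
Qed.

Section means.
Context (R : realType).

Definition Gamma (x : R) : R :=
  \int[lebesgue_measure]_(t in `[0%R, +oo[) (t `^ (x - 1) * expR (- t)).

Definition multi_beta (n : nat) (x : 'I_n -> R) : R :=
  (\prod_(i < n) Gamma (x i)) / Gamma (\sum_(i < n) x i).

(* The predicates of membership in E_n and int(E_n), on coordinate functions. *)
Definition simplex (n : nat) (x : 'I_n -> R) : Prop :=
  (forall i, 0 <= x i) /\ \sum_(i < n) x i <= 1.

Definition int_simplex (n : nat) (x : 'I_n -> R) : Prop :=
  (forall i, 0 < x i) /\ \sum_(i < n) x i < 1.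

(* (x_1, ..., x_n, x_{n+1}) with x_{n+1} = 1 - (x_1 + ... + x_n), the last
   coordinate being the one of index ord_max. *)
Definition bary (n : nat) (x : 'I_n -> R) (i : 'I_n.+1) : R :=
  if unlift ord_max i is Some j then x j else 1 - \sum_(j < n) x j.

Definition En (n : nat) : set (n.-tuple (measurableTypeR R)) :=
  [set t | simplex (tnth t)].

Definition int_En (n : nat) : set 'rV[R]_n := [set l | int_simplex (l ord0)].

Definition alpha (n : nat) (l : 'rV[R]_n) (i : 'I_n) : R :=
  bary (l ord0) ord_max / l ord0 i.

(* 0 `^ r = 0 for r < 0; this only matters on the boundary of E_n, a null set. *)
Definition density_lambda (n : nat) (l : 'rV[R]_n) (t : n.-tuple R) : R :=
  (\sum_(i < n) (alpha l i)^-1) / multi_beta (fun i => (alpha l i)^-1)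
  * \prod_(i < n) tnth t i `^ ((alpha l i)^-1 - 1).

Lemma Gamma_ge0 (x : R) : 0 <= Gamma x.
Proof.
by apply: Rintegral_ge0 => t _; rewrite mulr_ge0 ?powR_ge0 ?expR_ge0.
Qed.

Lemma density_lambda_ge0 (n : nat) (l : 'rV[R]_n) t :
  int_En l -> 0 <= density_lambda l t.
Proof.
move=> [l0 l1]; have al0 i : 0 <= (alpha l i)^-1.
  rewrite invr_ge0 divr_ge0 ?(ltW (l0 _))//.
  by rewrite /bary unlift_none subr_ge0 ltW.
rewrite mulr_ge0 ?divr_ge0//.
- exact: sumr_ge0.
- by apply: prodr_ge0 => i _; exact: Gamma_ge0.
- exact: Gamma_ge0.
- by apply: prodr_ge0 => i _; exact: powR_ge0.
Qed.

Lemma measurable_density_lambda (n : nat) (l : 'rV[R]_n) :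
  measurable_fun [set: n.-tuple (measurableTypeR R)] (density_lambda l).
Proof.
apply: measurable_funM => //; apply: measurable_prod => i _.
exact: (measurableT_comp (measurable_powR _) (measurable_tnth i)).
Qed.

Lemma measurable_En (n : nat) : measurable (@En n).
Proof.
have mt i : measurable_fun [set: n.-tuple (measurableTypeR R)]
    (fun t => tnth t i : R) by exact: measurable_tnth.
rewrite (_ : @En n = (\bigcap_(i in [set: 'I_n])
    ((fun t => tnth t i : R) @^-1` `[0%R, +oo[)) `&`
    (fun t => \sum_(i < n) tnth t i : R) @^-1` `]-oo, 1%R]).
  apply: measurableI.
    apply: fin_bigcap_measurable => // i _.
    by rewrite -[X in measurable X]setTI; exact: mt.
  rewrite -[X in measurable X]setTI.
  exact: measurable_sum.
apply/seteqP; split=> t /=.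
  by case=> t0 t1; split=> [i _|]; rewrite /= in_itv/= ?t0.
case=> t0; rewrite in_itv/= => t1; split=> // i.
by have := t0 i I; rewrite /= in_itv/= andbT.
Qed.

Section int_measure.
Context (n : nat) (l : 'rV[R]_n) (hl : int_En l).

Definition mu_int of int_En l :=
  fun A : set (n.-tuple (measurableTypeR R)) =>
    (\int[lebesgue_tuple R n]_(t in A `&` @En n) (density_lambda l t)%:E)%E.

Let d0 t : (0 <= (density_lambda l t)%:E)%E.
Proof. by rewrite lee_fin density_lambda_ge0. Qed.

Let mu_int0 : mu_int hl set0 = 0%E.
Proof. by rewrite /mu_int set0I integral_set0. Qed.

Let mu_int_ge0 A : (0 <= mu_int hl A)%E.
Proof. by apply: integral_ge0 => t _. Qed.

Let mu_int_sigma_additive : semi_sigma_additive (mu_int hl).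
Proof.
move=> F mF tF mUF; rewrite /mu_int setI_bigcupl.
rewrite ge0_integral_bigcup//.
- apply: is_cvg_ereal_nneg_natsum_cond => k _ _.
  by apply: integral_ge0 => t _.
- by move=> k; apply: measurableI => //; exact: measurable_En.
- apply/measurable_EFinP; apply: measurable_funTS.
  exact: measurable_density_lambda.
- exact: trivIset_setIr.
Qed.

HB.instance Definition _ := isMeasure.Build _ _ _ (mu_int hl)
  mu_int0 mu_int_ge0 mu_int_sigma_additive.

End int_measure.

(* The value mzero for l outside of int_En n is junk: it only makes mu_lambda
   total, so that it can be packed as a family of measures. *)
Definition mu_lambda (n : nat) (l : 'rV[R]_n) :
    {measure set (n.-tuple (measurableTypeR R)) -> \bar R} :=
  match pselect (int_En l) with
  | left hl => mu_int hl
  | right _ => mzero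
  end.

Lemma mu_lambdaE (n : nat) (l : 'rV[R]_n) A : int_En l ->
  mu_lambda l A =
    (\int[lebesgue_tuple R n]_(t in A `&` @En n) (density_lambda l t)%:E)%E.
Proof. by rewrite /mu_lambda; case: pselect. Qed.

Definition calL (n : nat) (l : 'rV[R]_n) (a : 'rV[R]_n.+1) : R :=
  \int[mu_lambda l]_(t in @En n) \prod_(i < n.+1) a ord0 i `^ bary (tnth t) i.

Definition bbL (n : nat) (l : 'rV[R]_n) (a : 'rV[R]_n.+1) : R :=
  (\int[mu_lambda l]_(t in @En n) (\sum_(i < n.+1) bary (tnth t) i * a ord0 i)^-1)^-1.

Definition pos_orthant (n : nat) : set 'rV[R]_n :=
  [set a | forall i, 0 < a ord0 i].

(* A family of maps is a total function, of which only the values at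
   l in int_En n and a in pos_orthant n.+1 are relevant; the point (1, ..., 1) at
   which the partial derivatives are taken is interior to pos_orthant. *)
Record weighted_multivariate_mean (n : nat)
    (m : 'rV[R]_n -> 'rV[R]_n.+1 -> R) : Prop := WeightedMultivariateMean {
  wmean_gt0 : forall l a, int_En l -> pos_orthant a -> 0 < m l a;
  wmean_min_max : forall l a, int_En l -> pos_orthant a ->
    \big[Num.min/a ord0 ord0]_(i < n.+1) a ord0 i <= m l a
      <= \big[Num.max/a ord0 ord0]_(i < n.+1) a ord0 i;
  wmean_vertex : forall a, pos_orthant a -> forall i : 'I_n,
    m l a @[l --> within (@int_En n) (nbhs (delta_mx ord0 i : 'rV[R]_n))]
      --> a ord0 (lift ord_max i);
  wmean_zero : forall a, pos_orthant a ->
    m l a @[l --> within (@int_En n) (nbhs (0 : 'rV[R]_n))] --> a ord0 ord_max;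
  wmean_sym : forall a, pos_orthant a -> forall s : {perm 'I_n.+1},
    m (const_mx (n.+1%:R^-1)) (col_perm s a) = m (const_mx (n.+1%:R^-1)) a;
  wmean_derive : forall l, int_En l -> forall i : 'I_n.+1,
    derivable (m l) (const_mx 1) (delta_mx ord0 i) /\
    'D_(delta_mx ord0 i) (m l) (const_mx 1) = bary (l ord0) i
}.

End means.

(* Main.v *)
Require Import Defs.
From mathcomp Require Import all_boot all_order all_algebra all_fingroup.
From mathcomp Require Import all_classical all_reals all_analysis.
From mathcomp Require Import measurable_realfun ring lra.

(** The measure [mu_lambda l] is the Dirichlet law of parameters
    (l_1/l_(n+1), ..., l_n/l_(n+1), 1): the Euler identity
    Gamma(x) Gamma(y) = Gamma(x+y) B(x,y), iterated along Tonelli's theorem, shows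
    that it has mass 1 and that the mean of the barycentric coordinates of t is
    [bary l].  Both integrands are squeezed between affine functions of t (AM-GM
    and the tangent line of 1/y), hence both families lie between the harmonic and
    the arithmetic mean of a with weights [bary l].  These two means have the same
    bounds, the same limits at the vertices and the same partial derivatives at
    (1, ..., 1), so only the symmetry remains.  At the barycenter the density is
    constant and the integrands are of the form h (b_1 t_1 + ... + b_(n+1) t_(n+1)):
    exchanging two adjacent b's is Tonelli's theorem, or the reflection of a
    segment when they are the last two. *)

Set Implicit Arguments.
Unset Strict Implicit.
Unset Printing Implicit Defensive.

Import Order.TTheory GRing.Theory Num.Theory.
Import numFieldNormedType.Exports.

Local Open Scope classical_set_scope.
Local Open Scope ring_scope.

(** * Lebesgue integration *)

Section lebesgue_affine.
Context {R : realType}.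
Local Notation mu := (@lebesgue_measure R).
Local Open Scope ereal_scope.

(** Lebesgue measure is determined by its values on the intervals ]a, b], and the preimage of such
    an interval under a translation has the same length. *)
Lemma lebesgue_measureD (c : R) (A : set (measurableTypeR R)) : measurable A ->
  pushforward mu (fun x => x + c : measurableTypeR R)%R A = mu A.
Proof.
have mc : measurable_fun [set: measurableTypeR R]
  (fun x => x + c : measurableTypeR R)%R by exact: measurable_funD.
move=> mA; apply/esym/(@lebesgue_measure_unique _
  (pushforward mu (fun x => x + c : measurableTypeR R)%R)) => //= _ [[a b]] _ <-.
rewrite /pushforward [X in _ = _ X](_ : _ = `](a - c)%R, (b - c)%R]%classic); last first.
  by apply/seteqP; split => x /=; rewrite !in_itv/= ltrBlDr lerBrDr.
rewrite !lebesgue_measure_itv/= !lte_fin ltrD2r.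
by case: ifP => // _; rewrite -!EFinD; congr EFin; ring.
Qed.

Lemma ge0_integral_translate (c : R) (f : R -> \bar R) :
  measurable_fun [set: R] f -> (forall x, 0 <= f x) ->
  \int[mu]_x f (x + c)%R = \int[mu]_x f x.
Proof.
move=> mf f0; have mc : measurable_fun [set: measurableTypeR R]
  (fun x => x + c : measurableTypeR R)%R by exact: measurable_funD.
transitivity (\int[pushforward mu (fun x => x + c : measurableTypeR R)%R]_x f x).
  by rewrite ge0_integral_pushforward//=.
by apply: eq_measure_integral => A mA _; exact: lebesgue_measureD.
Qed.

(** The reflection is negation, which preserves the measure, followed by the translation by [c]. *)
Lemma ge0_integral_reflect (c : R) (f : R -> \bar R) :
  measurable_fun [set: R] f -> (forall x, 0 <= f x) ->
  \int[mu]_x f (c - x)%R = \int[mu]_x f x.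
Proof.
move=> mf f0; rewrite -(ge0_integral_translate c mf f0).
pose g x := f (x + c)%R.
have mg : measurable_fun [set: R] g.
  by apply: measurableT_comp => //; exact: measurable_funD.
transitivity (\int[pushforward mu (-%R : _ -> measurableTypeR R)]_x g x).
  rewrite ge0_integral_pushforward//=; last by move=> x _; exact: f0.
  by apply: eq_integral => x _; rewrite /g /= addrC.
by apply: eq_measure_integral => A mA _; exact: lebesgue_measureN.
Qed.

(** Again by uniqueness on the intervals ]a, b]: the preimage is shorter by the factor [r]. *)
Lemma lebesgue_measureM (r : R) (A : set (measurableTypeR R)) :
  (0 < r)%R -> measurable A ->
  r%:E * pushforward mu (fun x => r * x : measurableTypeR R)%R A = mu A.
Proof.
move=> r0 mA; have mr : measurable_fun [set: measurableTypeR R]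
  (fun x => r * x : measurableTypeR R)%R by exact: measurable_funM.
apply/esym/(@lebesgue_measure_unique _ (mscale (NngNum (ltW r0))
  (pushforward mu (fun x => r * x : measurableTypeR R)%R))) => //= _ [[a b]] _ <-.
rewrite /mscale/= /pushforward [X in _ = _ * _ X](_ : _ =
    `](r^-1 * a)%R, (r^-1 * b)%R]%classic); last first.
  by apply/seteqP; split => x /=; rewrite !in_itv/= ltr_pdivrMl// ler_pdivlMl.
rewrite !lebesgue_measure_itv/= !lte_fin ltr_pM2l ?invr_gt0//.
case: ifP => // _; last by rewrite mule0.
by rewrite -!EFinD -EFinM -mulrBr mulrA divff ?mul1r ?gt_eqF.
Qed.

Lemma ge0_integral_dilate (r : R) (f : R -> \bar R) : (0 < r)%R ->
  measurable_fun [set: R] f -> (forall x, 0 <= f x) ->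
  \int[mu]_x f x = r%:E * \int[mu]_x f (r * x)%R.
Proof.
move=> r0 mf f0; have mr : measurable_fun [set: measurableTypeR R]
  (fun x => r * x : measurableTypeR R)%R by exact: measurable_funM.
(* The pushforward is packed as an opaque measure [nu], which can then be rescaled by [r]. *)
have [nu nuE] : exists nu : {measure set (measurableTypeR R) -> \bar R},
    (nu : set _ -> _) = pushforward mu (fun x => r * x : measurableTypeR R)%R.
  by unshelve (eexists; reflexivity).
rewrite -[X in _ * X](ge0_integral_pushforward mr mu measurableT mf)// -nuE.
apply: etrans (@ge0_integral_mscale _ _ _ nu setT measurableT (NngNum (ltW r0)) f mf _) => //.
apply: eq_measure_integral => A mA _.
by apply/esym; apply: etrans (lebesgue_measureM r0 mA); rewrite -nuE.
Qed.

End lebesgue_affine.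

(** * Integration against a measure given by a density *)

Section integral_density.
Context d (T : measurableType d) (R : realType).
Variables (mu nu : {measure set T -> \bar R}) (D : set T) (g : T -> R).
Local Open Scope ereal_scope.
Hypotheses (mD : measurable D) (mg : measurable_fun D g).
Hypothesis g0 : forall x, (0 <= g x)%R.
Hypothesis nuE : forall A, measurable A -> nu A = \int[mu]_(x in A `&` D) (g x)%:E.

Import HBNNSimple.

(** By linearity it is enough to treat the indicator of a level set of [h], and that case is
    [nuE]. *)
Let integral_density_nnsfun (h : {nnsfun T >-> R}) :
  \int[nu]_(x in D) (h x)%:E = \int[mu]_(x in D) ((h x)%:E * (g x)%:E).
Proof.
under eq_integral do rewrite fimfunE -fsumEFin//.
rewrite ge0_integral_fsum//; last 2 first.
- by move=> r; exact/measurable_EFinP/measurableT_comp.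
- by move=> n x _; rewrite EFinM nnfun_muleindic_ge0.
under [RHS]eq_integral.
  move=> x xD; rewrite fimfunE -fsumEFin// ge0_mule_fsuml; last first.
    by move=> r; rewrite EFinM nnfun_muleindic_ge0.
  over.
rewrite [RHS]ge0_integral_fsum//; last 2 first.
- move=> r; apply: emeasurable_funM; apply/measurable_EFinP => //.
  exact: measurableT_comp.
- move=> r x _; rewrite mule_ge0 ?lee_fin//.
  by rewrite -lee_fin EFinM nnfun_muleindic_ge0.
apply: eq_fsbigr => r _.
have mh : measurable (h @^-1` [set r]) by exact: measurable_sfunP.
(* A negative [r] is not a value of [h], so its level set is empty. *)
have [r0|r0] := leP 0%R r; last first.
  rewrite !integral0_eq// => x Dx; rewrite preimage_nnfun0// indic0/=;
  by rewrite mulr0 ?mul0e.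
rewrite integralZl_indic_nnsfun// integral_indic//.
transitivity (\int[mu]_(x in D) (r%:E * ((\1_(h @^-1` [set r]) x)%:E * (g x)%:E))).
  rewrite ge0_integralZl//.
  - rewrite nuE; last exact: measurableI.
    rewrite -setIA setIid; congr (_ * _).
    rewrite setIC integral_mkcondr; apply: eq_integral => x _.
    rewrite patchE indicE; case: ifPn => _; by rewrite ?mul1e ?mul0e.
  - by apply: emeasurable_funM; apply/measurable_EFinP.
  - by move=> x _; rewrite mule_ge0 ?lee_fin//.
by apply: eq_integral => x _; rewrite EFinM muleA.
Qed.

(** Simple functions increase to [f], and both sides pass to the limit by monotone convergence. *)
Lemma ge0_integral_density (f : T -> \bar R) :
  measurable_fun D f -> (forall x, D x -> 0 <= f x) ->
  \int[nu]_(x in D) f x = \int[mu]_(x in D) (f x * (g x)%:E).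
Proof.
move=> mf f0; pose f_ := nnsfun_approx mD mf.
transitivity (limn (fun n => \int[nu]_(x in D) (f_ n x)%:E)).
  rewrite -monotone_convergence//.
  - apply: eq_integral => y /[!inE] yD; apply/esym/cvg_lim => //.
    exact: cvg_nnsfun_approx.
  - by move=> n; exact/measurable_EFinP/measurable_funTS.
  - by move=> n y _; rewrite lee_fin.
  - by move=> y _ m n mn; rewrite lee_fin; exact/lefP/nd_nnsfun_approx.
under eq_fun do rewrite integral_density_nnsfun.
rewrite -monotone_convergence//.
- apply: eq_integral => y /[!inE] yD; apply/cvg_lim => //.
  by apply: cvgeZr => //; exact: cvg_nnsfun_approx.
- move=> n; apply: emeasurable_funM; apply/measurable_EFinP => //.
  exact: measurable_funTS.
- by move=> n y _; rewrite mule_ge0 ?lee_fin//.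
- move=> y _ m n mn; apply: lee_wpmul2r; rewrite lee_fin//.
  exact/lefP/nd_nnsfun_approx.
Qed.

End integral_density.

(** * The Gamma function *)

Section EGamma.
Context {R : realType}.
Local Notation mu := (@lebesgue_measure R).

(* t^(x-1) on the open half-line only: unlike the junk values of powR at 0, the
   convolution identities below then hold for every real argument. *)
Definition ppow (x t : R) : R := t `^ (x - 1) * \1_`]0, +oo[%classic t.

(** Gamma with values in [0, +oo], so that Tonelli's theorem can be applied before finiteness is
    established. *)
Definition EGamma (x : R) : \bar R :=
  (\int[mu]_t (ppow x t * expR (- t))%:E)%E.

(** The convolution of two truncated powers at [r]; at [r = 1] it is the beta function B(x, y). *)
Definition ppow_conv (x y r : R) : \bar R :=
  (\int[mu]_t (ppow x t * ppow y (r - t))%:E)%E.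

Lemma ppow_ge0 x t : 0 <= ppow x t.
Proof. by rewrite mulr_ge0 ?powR_ge0. Qed.

Lemma ppow_gt0E x t : 0 < t -> ppow x t = t `^ (x - 1).
Proof. by move=> t0; rewrite /ppow indicE mem_set ?mulr1//= in_itv/= t0. Qed.

Lemma ppow_le0E x t : t <= 0 -> ppow x t = 0.
Proof.
by move=> t0; rewrite /ppow indicE memNset ?mulr0//= in_itv/= andbT ltNge t0.
Qed.

Lemma measurable_ppow x : measurable_fun [set: R] (ppow x).
Proof. by apply: measurable_funM => //; exact: measurable_powR. Qed.

Lemma ppowM x r t : 0 < r -> ppow x (r * t) = r `^ (x - 1) * ppow x t.
Proof.
move=> r0; have [t0|t0] := ltP 0 t.
  by rewrite !ppow_gt0E ?mulr_gt0// powRM// ltW.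
by rewrite !ppow_le0E ?mulr0// pmulr_rle0.
Qed.

Lemma measurable_ppow_conv x y r :
  measurable_fun [set: R] (fun t => (ppow x t * ppow y (r - t))%:E).
Proof.
apply/measurable_EFinP/measurable_funM; first exact: measurable_ppow.
by apply: measurableT_comp; [exact: measurable_ppow|exact: measurable_funB].
Qed.

Lemma measurable_EGamma x :
  measurable_fun [set: R] (fun t => (ppow x t * expR (- t))%:E).
Proof.
apply/measurable_EFinP/measurable_funM; first exact: measurable_ppow.
by apply: measurableT_comp => //; exact: measurable_expR.
Qed.

Lemma EGamma_ge0 x : (0 <= EGamma x)%E.
Proof.
by apply: integral_ge0 => t _; rewrite lee_fin mulr_ge0 ?ppow_ge0 ?expR_ge0.
Qed.

Lemma ppow_conv_ge0 x y r : (0 <= ppow_conv x y r)%E.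
Proof. by apply: integral_ge0 => t _; rewrite lee_fin mulr_ge0 ?ppow_ge0. Qed.

(** Homogeneity: for [r > 0] the substitution t = r u extracts the factor r^(x+y-1); for [r <= 0]
    one of the two factors always vanishes. *)
Lemma ppow_convE x y r :
  ppow_conv x y r = ((ppow (x + y) r)%:E * ppow_conv x y 1)%E.
Proof.
have [r0|r0] := ltP 0 r; last first.
  rewrite ppow_le0E// mul0e /ppow_conv integral0_eq// => t _.
  have [t0|t0] := ltP 0 t; last by rewrite ppow_le0E ?mul0r.
  by rewrite (@ppow_le0E y) ?mulr0//; lra.
rewrite ppow_gt0E// [LHS](ge0_integral_dilate r0); last 2 first.
- exact: measurable_ppow_conv.
- by move=> t; rewrite lee_fin mulr_ge0 ?ppow_ge0.
rewrite /ppow_conv -ge0_integralZl//; last 3 first.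
- under eq_fun do rewrite -[X in X - _]mulr1 -mulrBr !ppowM//.
  by apply/measurable_EFinP/measurable_funM => //;
    apply: measurable_funM => //; [exact: measurable_ppow|];
    apply: measurableT_comp; [exact: measurable_ppow|exact: measurable_funB].
- by move=> t _; rewrite lee_fin mulr_ge0 ?ppow_ge0.
- by rewrite lee_fin ltW.
rewrite -ge0_integralZl//; last 3 first.
- exact: measurable_ppow_conv.
- by move=> t _; rewrite lee_fin mulr_ge0 ?ppow_ge0.
- by rewrite lee_fin powR_ge0.
apply: eq_integral => t _; rewrite -!EFinM; congr EFin.
rewrite -[X in X - _]mulr1 -mulrBr !ppowM// (_ : x + y - 1 = 1 + ((x - 1) + (y - 1))); last by ring.
have rD p q : r `^ (p + q) = r `^ p * r `^ q by rewrite powRD// (gt_eqF r0) implybT.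
by rewrite (rD 1) (rD (x - 1) (y - 1)) powRr1 ?ltW//; ring.
Qed.

(** The product is a double integral in (t, u). With v = t + u and the order of integration
    exchanged, the inner integral is a convolution at v, which [ppow_convE] reduces to its value at
    1. *)
Lemma EGammaM x y : (EGamma x * EGamma y = EGamma (x + y) * ppow_conv x y 1)%E.
Proof.
pose f (z : R * R) := (ppow x z.1 * ppow y (z.2 - z.1) * expR (- z.2))%:E.
have f0 z : (0 <= f z)%E by rewrite /f lee_fin; apply: mulr_ge0; [apply: mulr_ge0; exact: ppow_ge0|exact: expR_ge0].
have mf : measurable_fun [set: R * R] f.
  apply/measurable_EFinP/measurable_funM; last first.
    by apply: measurableT_comp; [exact: measurable_expR|exact: measurableT_comp].
  apply: measurable_funM; first by apply: measurableT_comp; [exact: measurable_ppow|].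
  by apply: measurableT_comp; [exact: measurable_ppow|exact: measurable_funB].
transitivity (\int[mu]_t \int[mu]_v f (t, v))%E.
  rewrite /EGamma -ge0_integralZr//; last 3 first.
  - exact: measurable_EGamma.
  - by move=> t _; rewrite lee_fin mulr_ge0 ?ppow_ge0 ?expR_ge0.
  - exact: EGamma_ge0.
  apply: eq_integral => t _.
  rewrite -ge0_integralZl//; last 3 first.
  - exact: measurable_EGamma.
  - by move=> u _; rewrite lee_fin mulr_ge0 ?ppow_ge0 ?expR_ge0.
  - by rewrite lee_fin mulr_ge0 ?ppow_ge0 ?expR_ge0.
  (* The substitution v = u + t, for fixed [t]. *)
  rewrite -[RHS](ge0_integral_translate t)//; last first.
    exact: (measurableT_comp mf).
  apply: eq_integral => u _; rewrite /f/= -EFinM addrK opprD expRD.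
  by congr EFin; ring.
rewrite fubini_tonelli// /EGamma -ge0_integralZr//; last 3 first.
- exact: measurable_EGamma.
- by move=> t _; rewrite lee_fin mulr_ge0 ?ppow_ge0 ?expR_ge0.
- exact: ppow_conv_ge0.
apply: eq_integral => v _; rewrite /f/= EFinM muleAC -ppow_convE.
rewrite /ppow_conv -ge0_integralZr//.
- exact: measurable_ppow_conv.
- by move=> t _; rewrite lee_fin mulr_ge0 ?ppow_ge0.
Qed.

(** The endpoint 0 is a null set; this links [ppow] to the closed half-line in the definition of
    [Gamma]. *)
Lemma integral_ppow (x : R) (f : R -> R) : measurable_fun [set: R] f ->
  (\int[mu]_t (ppow x t * f t)%:E =
   \int[mu]_(t in `[0%R, +oo[) (t `^ (x - 1) * f t)%:E)%E.
Proof.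
move=> mf; rewrite -integral_itv_obnd_cbnd; last first.
  by apply: measurable_funTS; apply/measurable_EFinP; exact: measurable_funM.
rewrite [RHS]integral_mkcond; apply: eq_integral => t _.
by rewrite patchE /ppow indicE; case: ifP; rewrite ?mulr1 ?mulr0 ?mul0r.
Qed.

Lemma GammaE x : Gamma x = fine (EGamma x).
Proof.
rewrite /EGamma (@integral_ppow x (fun t => expR (- t)))//.
by apply: measurableT_comp => //; exact: measurable_expR.
Qed.

(** The integrand is the exponential density of rate 1, of total mass 1. *)
Lemma EGamma1 : EGamma 1 = 1%E.
Proof.
rewrite -(@integral_exponential_pdf R 1 ltr01) /EGamma.
rewrite (@integral_ppow 1 (fun t => expR (- t))); last first.
  by apply: measurableT_comp => //; exact: measurable_expR.
rewrite integral_mkcond; apply: eq_integral => t _.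
rewrite /exponential_pdf !patchE; case: ifP => // _.
by rewrite subrr powRr0 !mul1r mulN1r.
Qed.

(** For [x < 1] the integrand is unbounded at 0, so the fundamental theorem of calculus is applied
    on [1/(n+2), 1] and n tends to infinity. *)
Lemma integral_powR_oc01 (x : R) : 0 < x ->
  (\int[mu]_(t in `]0%R, 1%R]) (t `^ (x - 1))%:E = (x^-1)%:E)%E.
Proof.
(* The shift by 2 makes the left endpoint strictly less than 1 for every [n]. *)
move=> x0; pose S n := `[n.+2%:R^-1 : R, 1%R]%classic.
have n0 n : 0 < n.+2%:R^-1 :> R by rewrite invr_gt0 ltr0n.
have US : \bigcup_n S n = `]0%R, 1%R]%classic.
  apply/seteqP; split => t /=.
    by move=> [n _]; rewrite /S/= !in_itv/= => /andP[nt ->]; rewrite (lt_le_trans _ nt).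
  rewrite in_itv/= => /andP[t0 t1].
  exists (Num.truncn t^-1) => //; rewrite /S/= in_itv/= t1 andbT.
  rewrite -[leRHS]invrK lef_pV2 ?posrE ?invr_gt0// ?ltr0n//.
  have := truncnS_gt t^-1; move/ltW/le_trans; apply; by rewrite ler_nat.
have F1 : (\int[mu]_(t in S n) (t `^ (x - 1))%:E @[n --> \oo] -->
    \int[mu]_(t in `]0%R, 1%R]) (t `^ (x - 1))%:E)%E.
  rewrite -US; apply: ge0_nondecreasing_set_cvg_integral.
  - move=> m n mn; apply/subsetPset => t; rewrite /S/= !in_itv/= => /andP[mt ->].
    rewrite andbT (le_trans _ mt)// lef_pV2 ?posrE ?ltr0n// ler_nat.
    by rewrite !ltnS.
  - by move=> n; exact: measurable_itv.
  - move=> n; apply: measurable_funTS; apply/measurable_EFinP.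
    exact: measurable_powR.
  - by move=> n t _; rewrite lee_fin powR_ge0.
have dpow (y t : R) : 0 < t -> derivable (fun a : R => a `^ y) t 1.
  by move=> t0; apply: derivable_powR; rewrite in_itv/= t0.
have cpow (y t : R) : 0 < t -> {for t, continuous (fun a : R => a `^ y)}.
  by move=> t0; apply/differentiable_continuous/derivable1_diffP; exact: dpow.
have F2 n : (\int[mu]_(t in S n) (t `^ (x - 1))%:E =
    (x^-1 - x^-1 * n.+2%:R^-1 `^ x)%:E)%E.
  rewrite (@continuous_FTC2 _ _ (fun t => x^-1 * t `^ x)).
  - by rewrite powR1 mulr1.
  - by rewrite invf_lt1 ?ltr1n ?ltr0n.
  - apply: derivable_within_continuous => t; rewrite in_itv/= => /andP[nt _].
    by apply: dpow; exact: lt_le_trans nt.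
  - split.
    + move=> t; rewrite in_itv/= => /andP[nt _]; apply: derivableM => //.
      by apply: dpow; exact: lt_trans nt.
    + apply: cvg_at_right_filter; apply: cvgM; first exact: cvg_cst.
      exact: cpow.
    + apply: cvg_at_left_filter; apply: cvgM; first exact: cvg_cst.
      exact: cpow.
  - move=> t; rewrite in_itv/= => /andP[nt _].
    have t0 : 0 < t by exact: lt_trans nt.
    rewrite derive1Ml; last exact: dpow.
    by rewrite powR_derive1 ?in_itv/= ?t0// mulrA mulVf ?mul1r// gt_eqF.
move: F1; under eq_fun do rewrite F2.
move=> F1; apply: (cvg_unique _ F1); first exact: ereal_hausdorff.
apply: cvg_EFin; first by near=> n.
rewrite -[X in _ --> X]subr0 -[X in _ - X](mulr0 x^-1).
apply: cvgB; first exact: cvg_cst.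
apply: cvgM; first exact: cvg_cst.
(* The sequence 1/(n+2) is a shifted harmonic sequence; it tends to 0 from the right, where t^x
   tends to 0. *)
apply: (cvg_at_rightP _ _ _).1 (powR_cvg0 x0) _ _; split => //.
have := @cvg_harmonic R; rewrite -(cvg_shiftS (@harmonic R)).
exact.
Unshelve. all: by end_near. Qed.

Lemma ppow_conv_x11 (x : R) : 0 < x -> ppow_conv x 1 1 = (x^-1)%:E.
Proof.
move=> x0; rewrite -integral_powR_oc01// -integral_itv_bndo_bndc; last first.
  by apply: measurable_funTS; apply/measurable_EFinP; exact: measurable_powR.
rewrite integral_mkcond; apply: eq_integral => t _.
rewrite patchE /ppow subrr powRr0 mul1r !indicE !mem_setE !in_itv/= !andbT.
by rewrite subr_gt0; case: (0 < t); case: (t < 1); rewrite ?mulr1 ?mulr0.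
Qed.

(** The Euler identity with y = 1, since Gamma(1) = 1 and B(x, 1) = 1/x; no integration by parts. *)
Lemma EGammaS (x : R) : 0 < x -> EGamma (x + 1) = (x%:E * EGamma x)%E.
Proof.
move=> x0; have := EGammaM x 1; rewrite EGamma1 mule1 ppow_conv_x11// => ->.
by rewrite muleC -muleA -EFinM mulVf ?mule1// gt_eqF.
Qed.

(** Induction on an integer bound for [x]: the functional equation brings [x] down to [x <= 1],
    where the integrand is at most t^(x-1) on ]0, 1] and at most exp(-t) beyond. *)
Lemma EGamma_lty (x : R) : 0 < x -> (EGamma x < +oo)%E.
Proof.
move=> x0; have [n] : exists n : nat, x <= n.+1%:R.
  by exists (Num.truncn x); exact/ltW/truncnS_gt.
elim: n x x0 => [|n IHn] x x0 xn; last first.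
  have [x1|x1] := leP x 1; first by apply: IHn => //; rewrite (le_trans x1)// ler1n.
  rewrite -(subrK 1 x) EGammaS ?subr_gt0//.
  rewrite lte_mul_pinfty ?lee_fin ?subr_ge0 ?(ltW x1)//.
  by apply: IHn; rewrite ?subr_gt0// lerBlDr natr1.
apply: (@le_lt_trans _ _ (\int[mu]_t
    ((t `^ (x - 1) * \1_`]0%R, 1%R]%classic t)%:E + (ppow 1 t * expR (- t))%:E))%E).
  apply: ge0_le_integral => //.
  - by move=> t _; rewrite lee_fin mulr_ge0 ?ppow_ge0 ?expR_ge0.
  - exact: measurable_EGamma.
  - apply: emeasurable_funD; last exact: measurable_EGamma.
    by apply/measurable_EFinP/measurable_funM => //; exact: measurable_powR.
  - move=> t _; rewrite -EFinD lee_fin.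
    have [t0|t0] := leP t 0.
      by rewrite !ppow_le0E// !mul0r addr0 mulr_ge0 ?powR_ge0.
    rewrite !ppow_gt0E// subrr powRr0 mul1r indicE.
    have [t1|t1] := leP t 1.
      rewrite mem_set/= ?in_itv/= ?t0// mulr1 ler_wpDr ?expR_ge0//.
      by rewrite ler_piMr ?powR_ge0// expR_le1 oppr_le0 ltW.
    rewrite ler_wpDl ?mulr_ge0 ?powR_ge0// ler_piMl ?expR_ge0//.
    by rewrite -[leRHS](powRr0 t) ler_powR ?(ltW t1)// subr_le0.
rewrite ge0_integralD//; first last.
- exact: measurable_EGamma.
- by move=> t _; rewrite lee_fin mulr_ge0 ?ppow_ge0 ?expR_ge0.
- by apply/measurable_EFinP/measurable_funM => //; exact: measurable_powR.
- by move=> t _; rewrite lee_fin mulr_ge0 ?powR_ge0.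
rewrite -[X in (_ + X)%E]/(EGamma 1) EGamma1.
rewrite (_ : (\int[mu]_t _)%E = (x^-1)%:E) ?ltry// -integral_powR_oc01//.
rewrite [RHS]integral_mkcond; apply: eq_integral => t _.
by rewrite patchE indicE; case: ifPn => _; rewrite ?mulr1 ?mulr0.
Qed.

Lemma EGamma_gt0 (x : R) : (0 < EGamma x)%E.
Proof.
(* On [1, 2] one has 0 <= ln t <= 1 and t <= 2, so [c] is a lower bound of the integrand there. *)
pose c := expR (- `|x - 1| - 2).
apply: (@lt_le_trans _ _ (\int[mu]_(t in `[1%R, 2%R]) c%:E)%E).
  rewrite integral_cst//= lebesgue_measure_itv/= lte_fin ltr1n.
  by rewrite -EFinB -EFinM lte_fin mulr_gt0 ?expR_gt0// subr_gt0 ltr1n.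
apply: (@le_trans _ _ (\int[mu]_(t in `[1%R, 2%R]) (ppow x t * expR (- t))%:E)%E).
  apply: ge0_le_integral => //.
  - by move=> t _; rewrite lee_fin expR_ge0.
  - by apply: measurable_funTS; exact: measurable_EGamma.
  - move=> t; rewrite /= in_itv/= => /andP[t1 t2].
    have t0 : 0 < t by lra.
    rewrite lee_fin ppow_gt0E// /powR gt_eqF// -expRD ler_expR.
    have lnt0 : 0 <= ln t by rewrite ln_ge0.
    have lnt1 : ln t <= 1.
      have t10 : -1 < t - 1 by lra.
      by have := le_ln1Dx t10; rewrite addrCA subrr addr0 => /le_trans; apply; lra.
    have : `|(x - 1) * ln t| <= `|x - 1|.
      by rewrite normrM ler_piMr// ger0_norm.
    rewrite ler_norml => /andP[+ _]; lra.
apply: ge0_subset_integral => //; first exact: measurable_EGamma.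
by move=> t _; rewrite lee_fin mulr_ge0 ?ppow_ge0 ?expR_ge0.
Qed.

Lemma EGamma_Gamma (x : R) : 0 < x -> EGamma x = (Gamma x)%:E.
Proof.
by move=> x0; rewrite GammaE fineK// ge0_fin_numE ?EGamma_ge0// EGamma_lty.
Qed.

Lemma Gamma_gt0 (x : R) : 0 < x -> 0 < Gamma x.
Proof. by move=> x0; rewrite -lte_fin -EGamma_Gamma// EGamma_gt0. Qed.

Lemma GammaS (x : R) : 0 < x -> Gamma (x + 1) = x * Gamma x.
Proof.
move=> x0; apply: EFin_inj; rewrite -EGamma_Gamma ?addr_gt0// EGammaS//.
by rewrite EGamma_Gamma.
Qed.

Lemma Gamma1 : Gamma 1 = 1 :> R.
Proof. by rewrite GammaE EGamma1. Qed.

(* The Euler integral of the first kind, rescaled to [0, r]. *)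
Lemma ppow_conv_Gamma (x y r : R) : 0 < x -> 0 < y ->
  ppow_conv x y r = (ppow (x + y) r * (Gamma x * Gamma y / Gamma (x + y)))%:E.
Proof.
move=> x0 y0; rewrite ppow_convE [RHS]EFinM; congr (_ * _)%E.
have xy0 : 0 < x + y by rewrite addr_gt0.
have := EGammaM x y; rewrite !EGamma_Gamma// -EFinM.
have G0 : 0 < Gamma (x + y) by exact: Gamma_gt0.
(* An infinite value would make the product of two finite Gamma values infinite. *)
case: (ppow_conv x y 1) (ppow_conv_ge0 x y 1) => [z _|_|//].
  by move=> [e]; rewrite e mulrC mulKf// gt_eqF.
by rewrite gt0_muley ?lte_fin.
Qed.

End EGamma.

(** * Integration over simplices *)

Section lebesgue_tuple_integral.
Context {R : realType}.
Local Notation mu := (@lebesgue_measure R).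
Local Notation T := (measurableTypeR R).

Lemma ge0_integral_lebesgue_tuple0 (f : 0.-tuple T -> \bar R) :
  measurable_fun setT f -> (forall t, 0 <= f t)%E ->
  (\int[lebesgue_tuple R 0]_t f t = f [tuple])%E.
Proof. by move=> mf f0; rewrite /= integral_dirac// diracT mul1e. Qed.

Lemma ge0_integral_lebesgue_tupleS n (f : n.+1.-tuple T -> \bar R) :
  measurable_fun setT f -> (forall t, 0 <= f t)%E ->
  (\int[lebesgue_tuple R n.+1]_t f t =
   \int[mu]_x \int[lebesgue_tuple R n]_t f (tuple_cons (x, t)))%E.
Proof.
move=> mf f0; rewrite /= ge0_integral_pushforward//; last exact: measurable_tuple_cons.
rewrite preimage_setT fubini_tonelli1//; last by move=> z; exact: f0.
by apply: measurableT_comp => //; exact: measurable_tuple_cons.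
Qed.

(** The size [r] varies because slicing a simplex at a first coordinate x leaves a simplex of size r
    - x. *)
Definition scaled_simplex n (r : R) : set (n.-tuple T) :=
  [set t | (forall i, 0 <= tnth t i) /\ \sum_(i < n) tnth t i <= r].

Lemma measurable_scaled_simplex n r : measurable (@scaled_simplex n r).
Proof.
have mt i : measurable_fun [set: n.-tuple T]
    (fun t => tnth t i : R) by exact: measurable_tnth.
rewrite (_ : @scaled_simplex n r = (\bigcap_(i in [set: 'I_n])
    ((fun t => tnth t i : R) @^-1` `[0%R, +oo[)) `&`
    (fun t => \sum_(i < n) tnth t i : R) @^-1` `]-oo, r]).
  apply: measurableI.
    apply: fin_bigcap_measurable => // i _.
    by rewrite -[X in measurable X]setTI; exact: mt.
  by rewrite -[X in measurable X]setTI; exact: measurable_sum.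
apply/seteqP; split=> t /=.
  by case=> t0 t1; split=> [i _|]; rewrite /= in_itv/= ?t0.
case=> t0; rewrite in_itv/= => t1; split=> // i.
by have := t0 i I; rewrite /= in_itv/= andbT.
Qed.

Lemma EnE n : @En R n = @scaled_simplex n 1. Proof. by []. Qed.

Lemma scaled_simplex0 r : 0 <= r -> @scaled_simplex 0 r = setT.
Proof.
by move=> r0; apply/seteqP; split => // t _; split => [[]//|]; rewrite big_ord0.
Qed.

Lemma scaled_simplex_cons n (r x : R) (t : n.-tuple T) :
  scaled_simplex r (tuple_cons (x, t)) <->
  x \in `[0, r] /\ scaled_simplex (r - x) t.
Proof.
have sE : \sum_(i < n.+1) tnth (tuple_cons (x, t)) i = x + \sum_(i < n) tnth t i.
  by rewrite big_ord_recl; congr (_ + _); apply: eq_bigr => i _; rewrite tnthS.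
rewrite /scaled_simplex/= sE in_itv/= lerBrDl.
split=> [[t0 tr]|[/andP[x0 xr] [t0 tr]]].
  have x0 : 0 <= x by exact: (t0 ord0).
  have t0' i : 0 <= tnth t i by have := t0 (lift ord0 i); rewrite tnthS.
  do 2?split => //; rewrite x0 (le_trans _ tr)// lerDl.
  by apply: sumr_ge0 => i _; exact: t0'.
by split=> // i; case: (unliftP ord0 i) => [j ->|->//]; rewrite tnthS.
Qed.

Lemma ge0_integral_scaled_simplexS n (r : R) (f : n.+1.-tuple T -> \bar R) :
  measurable_fun setT f -> (forall t, 0 <= f t)%E ->
  (\int[lebesgue_tuple R n.+1]_(t in scaled_simplex r) f t =
   \int[mu]_(x in `[0%R, r])
     \int[lebesgue_tuple R n]_(t in scaled_simplex (r - x)) f (tuple_cons (x, t)))%E.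
Proof.
move=> mf f0; rewrite integral_mkcond ge0_integral_lebesgue_tupleS; last 2 first.
- apply/(measurable_restrictT _ _).1; first exact: measurable_scaled_simplex.
  exact: measurable_funTS.
- by move=> t; rewrite patchE; case: ifP.
rewrite [RHS]integral_mkcond; apply: eq_integral => x _.
rewrite [RHS]patchE; case: ifPn => [xr|xr].
  rewrite [RHS]integral_mkcond; apply: eq_integral => t _.
  rewrite !patchE; congr (if _ then _ else _).
  apply/idP/idP => /set_mem h; apply/mem_set.
    by have [] := (scaled_simplex_cons _ _ _).1 h.
  by apply/scaled_simplex_cons; split => //; move: xr; rewrite mem_setE.
rewrite integral0_eq// => t _; rewrite patchE memNset//.
by move=> /scaled_simplex_cons[]; move: xr; rewrite mem_setE => /negbTE ->.
Qed.

End lebesgue_tuple_integral.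

(** * Dirichlet's integral *)

Section dirichlet.
Context {R : realType}.
Local Notation mu := (@lebesgue_measure R).
Local Notation T := (measurableTypeR R).

Lemma measurable_prod_powR n (x : 'I_n -> R) :
  measurable_fun [set: n.-tuple T]
    (fun t => (\prod_(i < n) tnth t i `^ (x i - 1))%:E).
Proof.
apply/measurable_EFinP; apply: measurable_prod => i _.
exact: (measurableT_comp (measurable_powR _) (measurable_tnth i)).
Qed.

Lemma prod_powR_ge0 n (x : 'I_n -> R) (t : n.-tuple R) :
  (0 <= (\prod_(i < n) tnth t i `^ (x i - 1))%:E)%E.
Proof. by rewrite lee_fin; apply: prodr_ge0 => i _; exact: powR_ge0. Qed.

(** Induction on [n]: by the induction hypothesis the slice at first coordinate u contributes a
    multiple of (r - u)^s, which leaves an Euler integral in u. *)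
Lemma dirichlet_integral n (x : 'I_n -> R) (r : R) :
  (forall i, 0 < x i) -> 0 <= r ->
  (\int[lebesgue_tuple R n]_(t in scaled_simplex r)
     (\prod_(i < n) tnth t i `^ (x i - 1))%:E =
   (r `^ (\sum_(i < n) x i) *
     (\prod_(i < n) Gamma (x i) / Gamma (\sum_(i < n) x i + 1)))%:E)%E.
Proof.
elim: n x r => [|n IHn] x r x0 r0.
  rewrite scaled_simplex0// ge0_integral_lebesgue_tuple0; last 2 first.
  - exact: measurable_prod_powR.
  - by move=> t; exact: prod_powR_ge0.
  by rewrite !big_ord0 add0r powRr0 Gamma1 divr1 mulr1.
rewrite ge0_integral_scaled_simplexS; last 2 first.
- exact: measurable_prod_powR.
- by move=> t; exact: prod_powR_ge0.
set s := \sum_(i < n) x (lift ord0 i).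
have s0 : 0 <= s by apply: sumr_ge0 => i _; exact/ltW.
set P := \prod_(i < n) Gamma (x (lift ord0 i)).
have P0 : 0 <= P by apply: prodr_ge0 => i _; exact: Gamma_ge0.
set C := P / Gamma (s + 1).
have C0 : 0 <= C by rewrite divr_ge0// Gamma_ge0.
transitivity (\int[mu]_(u in `[0%R, r]) ((C%:E * (u `^ (x ord0 - 1) * (r - u) `^ s)%:E)))%E.
  apply: eq_integral => u /set_mem; rewrite /= in_itv/= => /andP[u0 ur].
  transitivity (\int[lebesgue_tuple R n]_(t in scaled_simplex (r - u))
      ((u `^ (x ord0 - 1))%:E *
       (\prod_(i < n) tnth t i `^ (x (lift ord0 i) - 1))%:E))%E.
    apply: eq_integral => t _; rewrite big_ord_recl EFinM; congr (_ * _%:E)%E.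
    by apply: eq_bigr => i _; rewrite tnthS.
  rewrite ge0_integralZl; last 4 first.
  - exact: measurable_scaled_simplex.
  - by apply: measurable_funTS; exact: measurable_prod_powR.
  - by move=> t _; exact: prod_powR_ge0.
  - by rewrite lee_fin powR_ge0.
  rewrite IHn ?subr_ge0// -!EFinM; congr EFin.
  by rewrite -/s -/P -/C; ring.
have mp : measurable_fun [set: R] (fun u => u `^ (x ord0 - 1) * (r - u) `^ s).
  apply: measurable_funM => //.
  by apply: (measurableT_comp (measurable_powR _)); exact: measurable_funB.
rewrite ge0_integralZl; last 4 first.
- exact: measurable_itv.
- by apply: measurable_funTS; exact/measurable_EFinP.
- by move=> u _; rewrite lee_fin mulr_ge0 ?powR_ge0.
- by rewrite lee_fin.
(* Dropping the endpoints, a null set, produces [ppow]; the exponent [s] is [(s + 1) - 1]. *)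
transitivity (C%:E * ppow_conv (x ord0) (s + 1) r)%E.
  congr (_ * _)%E; rewrite integral_itv_bndoo; last first.
    by apply: measurable_funTS; exact/measurable_EFinP.
  rewrite integral_mkcond; apply: eq_integral => u _.
  rewrite patchE /ppow !indicE !mem_setE !in_itv/= !andbT subr_gt0 addrK.
  by case: (0 < u); case: (u < r); rewrite ?mulr1 ?mulr0 ?mul0r.
rewrite ppow_conv_Gamma ?ltr_wpDl// big_ord_recl -/s big_ord_recl -/P.
rewrite -EFinM; congr EFin.
have -> : ppow (x ord0 + (s + 1)) r = r `^ (x ord0 + s).
  (* At [r = 0] both sides vanish, as the exponent on the right is positive. *)
  move: r0; rewrite le_eqVlt => /predU1P[<-|r0].
    by rewrite ppow_le0E// powR0// gt_eqF// ltr_wpDr.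
  by rewrite ppow_gt0E// addrA addrK.
have G0 : Gamma (s + 1) != 0 by rewrite gt_eqF// Gamma_gt0// ltr_wpDl.
rewrite addrA /C; field; rewrite G0/= gt_eqF// Gamma_gt0//.
by rewrite ltr_wpDl// ltW// ltr_wpDr.
Qed.

End dirichlet.

(** * Barycentric coordinates and moments of the Dirichlet law *)

Section barycentric.
Context {R : realType} (n : nat).
Implicit Types (x : 'I_n -> R) (b : 'I_n.+1 -> R).

Lemma bary_lift x j : bary x (lift ord_max j) = x j.
Proof. by rewrite /bary liftK. Qed.

Lemma bary_max x : bary x ord_max = 1 - \sum_(j < n) x j.
Proof. by rewrite /bary unlift_none. Qed.

Lemma lift_max_widen (j : 'I_n) : lift ord_max j = widen_ord (leqnSn n) j.
Proof. by apply/val_inj; rewrite /= -[RHS]lift_max. Qed.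

Lemma sum_bary x b : \sum_(i < n.+1) bary x i * b i =
  \sum_(j < n) x j * b (lift ord_max j) + (1 - \sum_(j < n) x j) * b ord_max.
Proof.
rewrite big_ord_recr/= bary_max; congr (_ + _); apply: eq_bigr => j _.
by rewrite -lift_max_widen bary_lift.
Qed.

Lemma sum_bary1 x : \sum_(i < n.+1) bary x i = 1.
Proof.
transitivity (\sum_(i < n.+1) bary x i * 1); first by apply: eq_bigr => i _; rewrite mulr1.
by rewrite (sum_bary x (fun=> 1)); under eq_bigr do rewrite mulr1; ring.
Qed.

Lemma bary_ge0 x i : simplex x -> 0 <= bary x i.
Proof.
move=> [x0 x1]; case: (unliftP ord_max i) => [j ->|->].
  by rewrite bary_lift.
by rewrite bary_max subr_ge0.
Qed.

Lemma bary_gt0 x i : int_simplex x -> 0 < bary x i.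
Proof.
move=> [x0 x1]; case: (unliftP ord_max i) => [j ->|->].
  by rewrite bary_lift.
by rewrite bary_max subr_gt0.
Qed.

End barycentric.

(** * Inequalities between weighted means *)

Section weights.
Context {R : realType} (n : nat) (p : 'I_n.+1 -> R) (a : 'I_n.+1 -> R).
Hypotheses (p0 : forall i, 0 <= p i) (p1 : \sum_(i < n.+1) p i = 1).
Hypothesis a0 : forall i, 0 < a i.

(** The weights sum to 1, so they cannot all vanish. *)
Lemma wsum_gt0 : 0 < \sum_(i < n.+1) p i * a i.
Proof.
rewrite lt_neqAle eq_sym sumr_ge0 ?andbT; last first.
  by move=> i _; rewrite mulr_ge0// ltW.
apply/negP; rewrite psumr_eq0; last by move=> i _; rewrite mulr_ge0// ltW.
move=> /allP pa; have : \sum_(i < n.+1) p i = 0.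
  apply: big1 => i _; have := pa i (mem_index_enum i).
  by rewrite mulf_eq0 (gt_eqF (a0 i)) orbF => /eqP.
by rewrite p1 => /eqP; rewrite oner_eq0.
Qed.

Lemma wprod_expR : \prod_(i < n.+1) a i `^ p i = expR (\sum_(i < n.+1) p i * ln (a i)).
Proof.
by rewrite expR_sum; apply: eq_bigr => i _; rewrite /powR gt_eqF.
Qed.

Lemma wsum_le (b c : 'I_n.+1 -> R) : (forall i, b i <= c i) ->
  \sum_(i < n.+1) p i * b i <= \sum_(i < n.+1) p i * c i.
Proof. by move=> bc; apply: ler_sum => i _; rewrite ler_wpM2l. Qed.

Lemma wsum_cst c : \sum_(i < n.+1) p i * c = c.
Proof. by rewrite -mulr_suml p1 mul1r. Qed.

(** With A the arithmetic mean, ln (a_i / A) <= a_i / A - 1, and the weighted sum of the right-hand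
    sides is 0. *)
Lemma wgeom_le_arith :
  \prod_(i < n.+1) a i `^ p i <= \sum_(i < n.+1) p i * a i.
Proof.
set A := \sum_(i < n.+1) p i * a i; have A0 : 0 < A := wsum_gt0.
rewrite wprod_expR -[leRHS](@lnK _ A) ?posrE// ler_expR -subr_le0.
rewrite -(wsum_cst (ln A)) -sumrB.
rewrite (_ : \sum_(i < _) _ = \sum_(i < n.+1) p i * (ln (a i) - ln A)); last first.
  by apply: eq_bigr => i _; rewrite mulrBr.
apply: (@le_trans _ _ (\sum_(i < n.+1) p i * (a i / A - 1))).
  apply: wsum_le => i; rewrite -ln_div ?posrE//.
  have h : -1 < a i / A - 1 by rewrite ltrBrDl subrr divr_gt0.
  by have := le_ln1Dx h; rewrite addrCA subrr addr0.
have -> : \sum_(i < n.+1) p i * (a i / A - 1) = A / A - 1.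
  under eq_bigr do rewrite mulrBr mulrA.
  by rewrite sumrB wsum_cst// -mulr_suml.
by rewrite divff ?subrr// gt_eqF.
Qed.

End weights.

(** The left side is the tangent line of 1/y at [d]; the gap is (y - d)^2 / (y d^2). *)
Lemma inv_tangent (R : realFieldType) (y d : R) : 0 < y -> 0 < d ->
  2 / d - y / d ^+ 2 <= y^-1.
Proof.
move=> y0 d0; rewrite -subr_ge0.
rewrite (_ : _ - _ = (y - d) ^+ 2 / (y * d ^+ 2)); last first.
  by field; rewrite !gt_eqF.
by rewrite divr_ge0 ?sqr_ge0// mulr_ge0 ?sqr_ge0// ltW.
Qed.

Section weights_inv.
Context {R : realType} (n : nat) (p : 'I_n.+1 -> R) (a : 'I_n.+1 -> R).
Hypotheses (p0 : forall i, 0 <= p i) (p1 : \sum_(i < n.+1) p i = 1).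
Hypothesis a0 : forall i, 0 < a i.

(** AM-GM for the reciprocals of the [a i], inverted. *)
Lemma wharm_le_geom :
  (\sum_(i < n.+1) p i * (a i)^-1)^-1 <= \prod_(i < n.+1) a i `^ p i.
Proof.
have aV0 i : 0 < (a i)^-1 by rewrite invr_gt0.
have := wgeom_le_arith p0 p1 aV0.
rewrite !wprod_expR// => h; rewrite -[leRHS]invrK -expRN.
rewrite lef_pV2 ?posrE ?expR_gt0 ?wsum_gt0//.
rewrite (le_trans _ h)// ler_expR -sumrN; apply: ler_sum => i _.
by rewrite lnV ?posrE// mulrN.
Qed.

(** Jensen's inequality for 1/y: average the tangent line at the mean A, where it takes the value
    1/A. *)
Lemma inv_warith_le : (\sum_(i < n.+1) p i * a i)^-1 <= \sum_(i < n.+1) p i * (a i)^-1.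
Proof.
set A := \sum_(i < n.+1) p i * a i; have A0 : 0 < A by exact: wsum_gt0.
apply: (@le_trans _ _ (\sum_(i < n.+1) p i * (2 / A - a i / A ^+ 2))); last first.
  by apply: (wsum_le p0) => i; exact: inv_tangent.
have -> : \sum_(i < n.+1) p i * (2 / A - a i / A ^+ 2) = 2 / A - A / A ^+ 2.
  under eq_bigr do rewrite mulrBr [X in _ - X]mulrA.
  by rewrite sumrB wsum_cst// -mulr_suml.
by rewrite [leRHS](_ : _ = A^-1)//; field; rewrite gt_eqF.
Qed.

End weights_inv.

(** * Mass and mean of the Dirichlet law *)

Section moments.
Context {R : realType} (n : nat) (l : 'rV[R]_n).
Hypotheses (hn : (1 <= n)%N) (hl : int_En l).
Local Notation T := (measurableTypeR R).
Local Notation nu := (@mu_lambda R n l).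
Local Notation x := (fun i => (alpha l i)^-1).
Local Notation L := (1 - \sum_(i < n) l ord0 i).

Let L0 : 0 < L. Proof. by case: hl => _; rewrite subr_gt0. Qed.

Let xE i : (alpha l i)^-1 = l ord0 i / L.
Proof. by rewrite /alpha bary_max invf_div. Qed.

Let x0 i : 0 < (alpha l i)^-1.
Proof. by rewrite xE divr_gt0//; case: hl. Qed.

Let s := \sum_(i < n) (alpha l i)^-1.

Let s0 : 0 < s.
Proof.
rewrite /s; case: n hn l hl x0 => // m _ l' _ x0'.
by rewrite big_ord_recl ltr_pwDl// sumr_ge0// => i _; exact/ltW/x0'.
Qed.

Let s1E : s + 1 = L^-1.
Proof.
rewrite /s; under eq_bigr do rewrite xE.
by rewrite -mulr_suml; field; rewrite gt_eqF.
Qed.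

Lemma ge0_integral_mu_lambda (f : n.-tuple T -> \bar R) :
  measurable_fun (@En R n) f -> (forall t, @En R n t -> 0 <= f t)%E ->
  (\int[nu]_(t in @En R n) f t =
   \int[lebesgue_tuple R n]_(t in @En R n) (f t * (density_lambda l t)%:E))%E.
Proof.
apply: ge0_integral_density.
- exact: measurable_En.
- by apply: measurable_funTS; exact: measurable_density_lambda.
- by move=> t; exact: density_lambda_ge0.
- by move=> A _; exact: mu_lambdaE.
Qed.

(** With [y] equal to the parameters this computes the mass, and with one parameter raised by 1 a
    first moment. *)
Let integral_monomial (y : 'I_n -> R) : (forall i, 0 < y i) ->
  (\int[lebesgue_tuple R n]_(t in @En R n)
     ((s / multi_beta x)%:E * (\prod_(i < n) tnth t i `^ (y i - 1))%:E) =
   (s / multi_beta x * (\prod_(i < n) Gamma (y i) / Gamma (\sum_(i < n) y i + 1)))%:E)%E.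
Proof.
move=> y0; rewrite ge0_integralZl; last 4 first.
- exact: measurable_En.
- by apply: measurable_funTS; exact: measurable_prod_powR.
- by move=> t _; exact: prod_powR_ge0.
- rewrite lee_fin !divr_ge0 ?(ltW s0) ?Gamma_ge0//.
  by apply: prodr_ge0 => i _; exact: Gamma_ge0.
by rewrite EnE dirichlet_integral// powR1 mul1r.
Qed.

Let P0 : 0 < \prod_(i < n) Gamma (alpha l i)^-1.
Proof. by apply: prodr_gt0 => i _; exact: Gamma_gt0. Qed.

(** Everything cancels except s Gamma(s) / Gamma(s + 1) = 1. *)
Lemma mu_lambda_En : nu (@En R n) = 1%E.
Proof.
rewrite mu_lambdaE// setIid.
under eq_integral do rewrite /density_lambda EFinM.
rewrite integral_monomial// -/s GammaS// /multi_beta -/s.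
by congr EFin; field; rewrite !gt_eqF// Gamma_gt0.
Qed.

(** The factor t_i raises the i-th parameter x_i by 1; the functional equation of Gamma leaves x_i /
    (s + 1), where x_i = l_i / L and s + 1 = 1 / L. *)
Lemma integral_coord (i : 'I_n) :
  (\int[nu]_(t in @En R n) (tnth t i)%:E = (l ord0 i)%:E)%E.
Proof.
rewrite ge0_integral_mu_lambda; last 2 first.
- by apply: measurable_funTS; apply/measurable_EFinP; exact: measurable_tnth.
- by move=> t [t0 _]; rewrite lee_fin.
pose y j := (alpha l j)^-1 + (j == i)%:R.
have y0 j : 0 < y j by rewrite ltr_pwDl.
transitivity (\int[lebesgue_tuple R n]_(t in @En R n)
     ((s / multi_beta x)%:E * (\prod_(j < n) tnth t j `^ (y j - 1))%:E))%E.
  apply: eq_integral => t /set_mem[t0 _]; rewrite -!EFinM; congr EFin.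
  rewrite /density_lambda mulrCA; congr (_ * _).
  rewrite (bigD1 i)//= [RHS](bigD1 i)//= mulrA; congr (_ * _).
    (* The identity u u^(p-1) = u^p also holds at u = 0, because p is positive. *)
    by rewrite mulr_powRB1// /y eqxx addrK.
  by apply: eq_bigr => j ji; rewrite /y (negbTE ji) addr0.
rewrite integral_monomial//; congr EFin.
have -> : \sum_(j < n) y j = s + 1.
  rewrite big_split/= -/s; congr (_ + _).
  by rewrite (bigD1 i)//= eqxx big1 ?addr0// => j /negbTE ->.
have -> : \prod_(j < n) Gamma (y j) = (alpha l i)^-1 * \prod_(j < n) Gamma (alpha l j)^-1.
  rewrite (bigD1 i)//= [in RHS](bigD1 i)//= mulrA /y eqxx GammaS//; congr (_ * _).
  by apply: eq_bigr => j /negbTE ->; rewrite addr0.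
have s10 : 0 < s + 1 by rewrite ltr_wpDl// ltW.
rewrite GammaS// GammaS// /multi_beta -/s.
transitivity ((alpha l i)^-1 / (s + 1)).
  set xi := (alpha l i)^-1; set P := \prod_(j < n) _.
  by field; rewrite !gt_eqF//=; exact: Gamma_gt0.
by rewrite s1E invrK xE divfK// gt_eqF.
Qed.

Lemma mu_lambda_integrable (f : n.-tuple T -> R) (M : R) :
  measurable_fun [set: n.-tuple T] f ->
  (forall t, @En R n t -> `|f t| <= M) ->
  nu.-integrable (@En R n) (EFin \o f).
Proof.
move=> mf fM; apply: measurable_bounded_integrable.
- exact: measurable_En.
- by rewrite mu_lambda_En ltry.
- exact: measurable_funTS.
- exists M; split; first exact: num_real.
  by move=> K MK t /fM/le_trans; apply; exact: ltW.
Qed.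

Lemma En_coord_le1 (t : n.-tuple T) i : @En R n t -> 0 <= tnth t i <= 1.
Proof.
move=> [t0 t1]; rewrite t0 (le_trans _ t1)// (bigD1 i)//= lerDl.
by apply: sumr_ge0 => j _.
Qed.

Lemma expect_affine (c0 : R) (c : 'I_n -> R) :
  nu.-integrable (@En R n)
    (EFin \o (fun t : n.-tuple T => c0 + \sum_(j < n) c j * tnth t j)) /\
  \int[nu]_(t in @En R n) (c0 + \sum_(j < n) c j * tnth t j) =
  c0 + \sum_(j < n) c j * l ord0 j.
Proof.
have mE := @measurable_En R n.
have ic : nu.-integrable (@En R n) (EFin \o (fun _ : n.-tuple T => c0)).
  by apply: (@mu_lambda_integrable _ `|c0|).
have it j : nu.-integrable (@En R n) (EFin \o (fun t : n.-tuple T => tnth t j : R)).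
  apply: (@mu_lambda_integrable _ 1); first exact: measurable_tnth.
  by move=> t /(En_coord_le1 j)/andP[t0 t1]; rewrite ger0_norm.
have ict j : nu.-integrable (@En R n)
    (EFin \o (fun t : n.-tuple T => c j * tnth t j : R)).
  by apply: (integrableZl mE (c j) (it j)).
have [iS eS] : nu.-integrable (@En R n) (EFin \o (fun t : n.-tuple T =>
      \sum_(j < n) c j * tnth t j)) /\
    \int[nu]_(t in @En R n) (\sum_(j < n) c j * tnth t j) =
    \sum_(j < n) c j * l ord0 j.
  (* Linearity, by induction over an arbitrary list of indices. *)
  elim: (index_enum _) => [|j r [ir er]].
    split; first by under eq_fun do rewrite big_nil; exact: integrable0.
    by rewrite big_nil; under eq_Rintegral do rewrite big_nil; rewrite Rintegral_cst// mul0r.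
  split.
    rewrite (_ : EFin \o _ = (EFin \o (fun t : n.-tuple T => c j * tnth t j : R)) \+
      (EFin \o (fun t : n.-tuple T => \sum_(j <- r) c j * tnth t j))); last first.
      by apply/funext => t /=; rewrite big_cons EFinD.
    exact: integrableD.
  rewrite big_cons; under eq_Rintegral do rewrite big_cons.
  rewrite RintegralD// er RintegralZl//; congr (_ * _ + _).
  by rewrite /Rintegral integral_coord.
split; last by rewrite RintegralD// eS Rintegral_cst// mu_lambda_En mulr1.
rewrite (_ : EFin \o _ = (EFin \o (fun _ : n.-tuple T => c0)) \+
  (EFin \o (fun t : n.-tuple T => \sum_(j < n) c j * tnth t j)))//.
exact: integrableD.
Qed.

(** Eliminating the last coordinate gives an affine function of t. The constant [c0] accommodates
    the constant term of a tangent line. *)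
Lemma expect_bary (c0 : R) (b : 'I_n.+1 -> R) :
  nu.-integrable (@En R n)
    (EFin \o (fun t : n.-tuple T => c0 + \sum_(i < n.+1) bary (tnth t) i * b i)) /\
  \int[nu]_(t in @En R n) (c0 + \sum_(i < n.+1) bary (tnth t) i * b i) =
  c0 + \sum_(i < n.+1) bary (l ord0) i * b i.
Proof.
have H (z : 'I_n -> R) : c0 + \sum_(i < n.+1) bary z i * b i =
    c0 + b ord_max + \sum_(j < n) (b (lift ord_max j) - b ord_max) * z j.
  have -> : \sum_(j < n) (b (lift ord_max j) - b ord_max) * z j =
      \sum_(j < n) z j * b (lift ord_max j) - (\sum_(j < n) z j) * b ord_max.
    by rewrite mulr_suml -sumrB; apply: eq_bigr => j _; ring.
  by rewrite sum_bary; ring.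
have [h1 h2] := expect_affine (c0 + b ord_max) (fun j => b (lift ord_max j) - b ord_max).
split; first by under eq_fun do rewrite H.
by rewrite H -h2; apply: eq_Rintegral => t _; rewrite H.
Qed.

End moments.

(** * Harmonic and arithmetic bounds *)

Section mean_bounds.
Context {R : realType} (n : nat).
Hypothesis hn : (1 <= n)%N.
Local Notation T := (measurableTypeR R).
Implicit Types (l : 'rV[R]_n) (a : 'rV[R]_n.+1).

Lemma measurable_sum_bary (b : 'I_n.+1 -> R) :
  measurable_fun [set: n.-tuple T]
    (fun t => \sum_(i < n.+1) bary (tnth t) i * b i).
Proof.
under eq_fun do rewrite sum_bary.
have mt i : measurable_fun [set: n.-tuple T]
    (fun t => tnth t i : R) by exact: measurable_tnth.
apply: measurable_funD.
  by apply: measurable_sum => i; apply: measurable_funM.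
by apply: measurable_funM => //; apply: measurable_funB => //; exact: measurable_sum.
Qed.

(** The integrand becomes a function of one affine form in t, the shape on which the symmetry
    argument works. *)
Lemma calL_expR l a : pos_orthant a -> calL l a =
  \int[mu_lambda l]_(t in @En R n)
    expR (\sum_(i < n.+1) bary (tnth t) i * ln (a ord0 i)).
Proof. by move=> a0; apply: eq_Rintegral => t _; rewrite wprod_expR. Qed.

Lemma En_sum_bary_gt0 (b : 'I_n.+1 -> R) (t : n.-tuple T) :
  (forall i, 0 < b i) -> @En R n t -> 0 < \sum_(i < n.+1) bary (tnth t) i * b i.
Proof.
by move=> b0 tE; apply: wsum_gt0 => // [i|]; [exact: bary_ge0|exact: sum_bary1].
Qed.

(** On positive reals [expR (- ln y)] is 1/y; unlike the inverse, it is nonnegative on the whole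
    line. *)
Lemma bbL_expR l a : pos_orthant a -> bbL l a =
  (\int[mu_lambda l]_(t in @En R n)
    expR (- ln (\sum_(i < n.+1) bary (tnth t) i * a ord0 i)))^-1.
Proof.
move=> a0; congr (_^-1); apply: eq_Rintegral => t /set_mem tE.
by rewrite expRN lnK// posrE En_sum_bary_gt0.
Qed.

Lemma En_sum_bary_le (b : 'I_n.+1 -> R) (t : n.-tuple T) :
  (forall i, 0 < b i) -> @En R n t ->
  \sum_(i < n.+1) bary (tnth t) i * b i <= \sum_(i < n.+1) b i.
Proof.
move=> b0 tE; rewrite -[leRHS](wsum_cst (sum_bary1 (tnth t))).
apply: wsum_le => [i|i]; first exact: bary_ge0.
by rewrite (bigD1 i)//= lerDl sumr_ge0// => j _; exact/ltW.
Qed.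

(** The upper bound is the expectation of an affine function. For the lower one, 1/y is minorized by
    its tangent at the mean [d] of the form with coefficients [b], and that tangent has expectation
    1/d. *)
Lemma expect_squeeze l (b c : 'I_n.+1 -> R) (f : n.-tuple T -> R) :
  int_En l -> (forall i, 0 < b i) -> (forall i, 0 < c i) ->
  measurable_fun [set: n.-tuple T] f ->
  (forall t, @En R n t -> (\sum_(i < n.+1) bary (tnth t) i * b i)^-1 <= f t
      <= \sum_(i < n.+1) bary (tnth t) i * c i) ->
  (\sum_(i < n.+1) bary (l ord0) i * b i)^-1 <= \int[mu_lambda l]_(t in @En R n) f t
    <= \sum_(i < n.+1) bary (l ord0) i * c i.
Proof.
move=> hl b0 c0 mf fbc; set d := \sum_(i < n.+1) bary (l ord0) i * b i.
have d0 : 0 < d.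
  by apply: wsum_gt0 => // [i|]; [exact/ltW/bary_gt0|exact: sum_bary1].
have mE := @measurable_En R n.
have fi : (mu_lambda l).-integrable (@En R n) (EFin \o f).
  apply: (@mu_lambda_integrable _ _ _ hn hl _ (\sum_(i < n.+1) c i)) => // t tE.
  have /andP[f1 f2] := fbc t tE.
  have f0 : 0 <= f t by rewrite (le_trans _ f1)// invr_ge0 ltW// En_sum_bary_gt0.
  by rewrite ger0_norm// (le_trans f2)// En_sum_bary_le.
have [ic ec] := expect_bary hn hl 0 c.
(* The tangent line [2 / d - y / d ^+ 2], expressed in barycentric coordinates. *)
have [ib eb] := expect_bary hn hl (2 / d) (fun i => b i * (- d ^- 2)).
have bE (z : 'I_n -> R) : \sum_(i < n.+1) bary z i * (b i * (- d ^- 2)) =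
    - ((\sum_(i < n.+1) bary z i * b i) / d ^+ 2).
  by rewrite mulr_suml -sumrN; apply: eq_bigr => i _; rewrite mulrA mulrN.
apply/andP; split.
  have -> : d^-1 = 2 / d + \sum_(i < n.+1) bary (l ord0) i * (b i * (- d ^- 2)).
    by rewrite bE -/d; field; rewrite gt_eqF.
  rewrite -eb; apply: le_Rintegral => // t tE.
  have /andP[f1 _] := fbc t tE; rewrite (le_trans _ f1)// bE.
  by apply: inv_tangent => //; exact: En_sum_bary_gt0.
rewrite -[leRHS]add0r -ec; apply: le_Rintegral => // t tE.
by rewrite add0r; have /andP[] := fbc t tE.
Qed.

Definition harmonic_arithmetic_bounds (m : 'rV[R]_n -> 'rV[R]_n.+1 -> R) :=
  forall l a, int_En l -> pos_orthant a ->
  (\sum_(i < n.+1) bary (l ord0) i * (a ord0 i)^-1)^-1 <= m l a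
    <= \sum_(i < n.+1) bary (l ord0) i * a ord0 i.

(** For each t, the weighted geometric mean with weights [bary (tnth t)] lies between the harmonic
    and the arithmetic ones; then average over t. *)
Lemma calL_bounds : harmonic_arithmetic_bounds (@calL R n).
Proof.
move=> l a hl a0; rewrite calL_expR//.
have aV0 i : 0 < (a ord0 i)^-1 by rewrite invr_gt0.
apply: expect_squeeze => //.
  by apply: (measurableT_comp (@measurable_expR R)); exact: measurable_sum_bary.
move=> t tE; rewrite -wprod_expR//.
have p0 i : 0 <= bary (tnth t) i by exact: bary_ge0.
have p1 := sum_bary1 (tnth t).
by rewrite wharm_le_geom// wgeom_le_arith.
Qed.

(** The squeeze is applied to the integral before inversion, with the coefficients a_i below and
    1/a_i above; inverting exchanges the two bounds. *)
Lemma bbL_bounds : harmonic_arithmetic_bounds (@bbL R n).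
Proof.
move=> l a hl a0; rewrite bbL_expR//.
have aV0 i : 0 < (a ord0 i)^-1 by rewrite invr_gt0.
have w0 i : 0 <= bary (l ord0) i by exact/ltW/bary_gt0.
have w1 := sum_bary1 (l ord0).
have /andP[h1 h2] : (\sum_(i < n.+1) bary (l ord0) i * a ord0 i)^-1 <=
  \int[mu_lambda l]_(t in @En R n)
    expR (- ln (\sum_(i < n.+1) bary (tnth t) i * a ord0 i))
  <= \sum_(i < n.+1) bary (l ord0) i * (a ord0 i)^-1.
  apply: expect_squeeze => //.
    apply: (measurableT_comp (@measurable_expR R)).
    apply: (measurableT_comp (@oppr_measurable R setT)).
    by apply: (measurableT_comp (@measurable_ln R)); exact: measurable_sum_bary.
  move=> t tE; rewrite expRN lnK ?posrE ?En_sum_bary_gt0// lexx/=.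
  have p0 i : 0 <= bary (tnth t) i by exact: bary_ge0.
  by apply: inv_warith_le => //; exact: sum_bary1.
have A0 : 0 < (\sum_(i < n.+1) bary (l ord0) i * a ord0 i)^-1.
  by rewrite invr_gt0 wsum_gt0.
have I0 := lt_le_trans A0 h1.
apply/andP; split; first by rewrite lef_pV2 ?posrE// wsum_gt0.
by rewrite -[leRHS]invrK lef_pV2 ?posrE.
Qed.

End mean_bounds.

(** * From the two bounds to the axioms of a mean *)

Section mean_of_bounds.
Context {R : realType} (n : nat) (m : 'rV[R]_n -> 'rV[R]_n.+1 -> R).
Hypothesis mb : harmonic_arithmetic_bounds m.
Hypothesis msym : forall a, pos_orthant a -> forall s : {perm 'I_n.+1},
  m (const_mx (n.+1%:R^-1)) (col_perm s a) = m (const_mx (n.+1%:R^-1)) a.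

Lemma continuous_sum_bary (b : 'I_n.+1 -> R) :
  continuous (fun l : 'rV[R]_n => \sum_(i < n.+1) bary (l ord0) i * b i).
Proof.
under eq_fun do rewrite sum_bary.
have ct i : continuous (fun l : 'rV[R]_n => l ord0 i) by exact: coord_continuous.
have cs (g : 'I_n -> 'rV[R]_n -> R) : (forall i, continuous (g i)) ->
    continuous (fun l => \sum_(i < n) g i l).
  by move=> cg; apply: continuous_big => //; exact: add_continuous.
have c1 : continuous (fun l : 'rV[R]_n => \sum_(j < n) l ord0 j * b (lift ord_max j)).
  by apply: cs => i l; exact: (cvgM (ct i l) (cvg_cst _)).
have c2 : continuous (fun l : 'rV[R]_n => \sum_(j < n) l ord0 j) by exact: cs.
move=> l; exact: (cvgD (c1 l) (cvgM (cvgB (cvg_cst _) (c2 l)) (cvg_cst _))).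
Qed.

(** Both bounds are continuous in l at the vertex [l0] and equal [a ord0 k] there, so [m] is
    squeezed. *)
Lemma cvg_of_bounds (a : 'rV[R]_n.+1) (l0 : 'rV[R]_n) (k : 'I_n.+1) :
  pos_orthant a -> (forall i, bary (l0 ord0) i = (i == k)%:R) ->
  m l a @[l --> within (@int_En R n) (nbhs l0)] --> a ord0 k.
Proof.
move=> a0 l0k.
have E b : \sum_(i < n.+1) bary (l0 ord0) i * b i = b k.
  rewrite (bigD1 k)//= l0k eqxx mul1r big1 ?addr0// => i /negbTE ik.
  by rewrite l0k ik mul0r.
have c2 := @continuous_sum_bary (a ord0) l0.
have c1 : (fun l : 'rV[R]_n =>
    (\sum_(i < n.+1) bary (l ord0) i * (a ord0 i)^-1)^-1) @ l0 --> a ord0 k.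
  have := @continuous_sum_bary (fun i => (a ord0 i)^-1) l0.
  rewrite /continuous_at (E (fun i => (a ord0 i)^-1)) => c.
  have ak : (a ord0 k)^-1 != 0 by rewrite gt_eqF// invr_gt0.
  by rewrite -(invrK (a ord0 k)); exact: (cvgV ak c).
rewrite /continuous_at (E (a ord0)) in c2.
have near_mb : within (@int_En R n) (nbhs l0) (fun l : 'rV[R]_n =>
    (\sum_(i < n.+1) bary (l ord0) i * (a ord0 i)^-1)^-1 <= m l a
      <= \sum_(i < n.+1) bary (l ord0) i * a ord0 i).
  by apply: filterS (withinT _ _) => l hl; exact: mb.
have w1 := @cvg_within_filter _ _ _ _ (nbhs_filter l0) _ (@int_En R n) c1.
have w2 := @cvg_within_filter _ _ _ _ (nbhs_filter l0) _ (@int_En R n) c2.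
have FF : Filter (within (@int_En R n) (nbhs l0)) by exact: within_filter.
exact (@squeeze_cvgr _ _ FF R _ _ (m^~ a) near_mb _ w1 w2).
Qed.

(** Evaluates both bounds along a coordinate line through (1, ..., 1): e = h for the arithmetic one,
    e = 1/(1+h) - 1 for the harmonic one. *)
Lemma sum_bary_perturb (z : 'I_n -> R) (e : R) (i : 'I_n.+1) (b : 'I_n.+1 -> R) :
  (forall j, b j = 1 + e * (j == i)%:R) ->
  \sum_(j < n.+1) bary z j * b j = 1 + bary z i * e.
Proof.
move=> bE; under eq_bigr do rewrite bE mulrDr mulr1.
rewrite big_split/= sum_bary1; congr (_ + _).
rewrite (bigD1 i)//= eqxx mulr1 big1 ?addr0// => j /negbTE ->.
by rewrite !mulr0.
Qed.

(* Both bounds equal 1 at (1, ..., 1) and have the same derivative there. *)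
Lemma cvg_derive_of_bounds l (i : 'I_n.+1) : int_En l ->
  h^-1 *: ((m l \o shift (const_mx 1)) (h *: delta_mx ord0 i) - m l (const_mx 1))
    @[h --> 0^'] --> bary (l ord0) i.
Proof.
move=> hl; set w := bary (l ord0) i.
have w0 : 0 < w by exact: bary_gt0.
have w1 : w <= 1.
  rewrite -(sum_bary1 (l ord0)) (bigD1 i)//= lerDl sumr_ge0// => j _.
  exact/ltW/bary_gt0.
have m1 : m l (const_mx 1) = 1.
  have p1 : pos_orthant (const_mx 1 : 'rV[R]_n.+1) by move=> j; rewrite mxE.
  have := mb hl p1; under eq_bigr do rewrite mxE invr1.
  rewrite (wsum_cst (sum_bary1 (l ord0))) invr1; under eq_bigr do rewrite mxE.
  by rewrite (wsum_cst (sum_bary1 (l ord0))) => h; apply/esym/le_anti.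
apply/cvgrPdist_le => e e0; near=> h.
have h0 : h != 0 by near: h; exact: nbhs_dnbhs_neq.
(* This keeps 1 + h and the denominator below at least 1/2; the next condition turns the error 2 h^2
   into at most e |h|. *)
have h2 : `|h| <= 2^-1.
  near: h; apply: dnbhs0_le; lra.
have he : `|h| <= e / 2.
  near: h; apply: dnbhs0_le; lra.
set ah := (shift (const_mx 1) (h *: delta_mx ord0 i) : 'rV[R]_n.+1).
have /andP[hl2 hg2] : - 2^-1 <= h <= 2^-1 by rewrite -ler_norml.
have ahE j : ah ord0 j = 1 + h * (j == i)%:R.
  by rewrite /ah/= !mxE eqxx/= addrC.
have ahVE j : (ah ord0 j)^-1 = 1 + ((1 + h)^-1 - 1) * (j == i)%:R.
  by rewrite ahE; case: (j == i); rewrite ?mulr1 ?mulr0 ?addr0 ?invr1//; ring.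
have pah : pos_orthant ah.
  by move=> j; rewrite ahE; case: (j == i); rewrite ?mulr1 ?mulr0 ?addr0//; lra.
have := mb hl pah; rewrite (sum_bary_perturb _ ahE) (sum_bary_perturb _ ahVE) -/w.
rewrite /= -/ah m1 => /andP[]; set M := m l ah => M1 M2.
have D0 : 2^-1 <= 1 + (1 - w) * h by nra.
have M1' : - (2 * h ^+ 2) <= M - 1 - w * h.
  apply: (@le_trans _ _ ((1 + w * ((1 + h)^-1 - 1))^-1 - 1 - w * h)); last by lra.
  (* The harmonic bound differs from 1 + w h by exactly this second-order term. *)
  rewrite (_ : _ - _ - _ = - (w * (1 - w) * h ^+ 2 / (1 + (1 - w) * h))); last first.
    by field; apply/andP; split; rewrite gt_eqF//; lra.
  rewrite lerN2 ler_pdivrMr; last by lra.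
  have : 0 <= h ^+ 2 by exact: sqr_ge0.
  move: (h ^+ 2) => q q0.
  have w4 : w * (1 - w) <= 1 by nra.
  have : 0 <= q * (1 - w * (1 - w)) by apply: mulr_ge0 => //; lra.
  have : 0 <= q * (1 + (1 - w) * h - 2^-1) by apply: mulr_ge0 => //; lra.
  nra.
rewrite distrC (_ : _ - _ = (M - 1 - w * h) / h); last first.
  by rewrite /GRing.scale/=; field.
rewrite normrM normfV ler_pdivrMr ?normr_gt0//.
(* The arithmetic bound is exactly 1 + w h, so the difference is nonpositive. *)
rewrite ler0_norm; last by lra.
apply: (@le_trans _ _ (2 * h ^+ 2)); first by lra.
rewrite -real_normK ?num_real// expr2 mulrA ler_wpM2r//.
by rewrite -ler_pdivlMl// mulrC.
Unshelve. all: by end_near. Qed.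

Lemma weighted_mean_of_bounds : weighted_multivariate_mean m.
Proof.
have H0 (l : 'rV[R]_n) (a : 'rV[R]_n.+1) : int_En l -> pos_orthant a ->
    0 < \sum_(i < n.+1) bary (l ord0) i * (a ord0 i)^-1.
  move=> hl a0; apply: wsum_gt0 => [i||i]; last by rewrite invr_gt0.
    exact/ltW/bary_gt0.
  exact: sum_bary1.
split=> //.
- move=> l a hl a0; have /andP[h _] := mb hl a0.
  by apply: lt_le_trans h; rewrite invr_gt0 H0.
- move=> l a hl a0; have /andP[h1 h2] := mb hl a0.
  have w0 i : 0 <= bary (l ord0) i by exact/ltW/bary_gt0.
  have w1 := sum_bary1 (l ord0).
  apply/andP; split.
    (* Every 1/a_i is at most 1/min, hence so is their weighted mean. *)
    apply: le_trans h1; set mn := \big[_/_]_(_ < _) _.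
    have mn0 : 0 < mn by apply: lt_bigmin => // i _.
    rewrite -[leLHS]invrK lef_pV2 ?posrE ?invr_gt0 ?H0//.
    rewrite -[leRHS](wsum_cst w1); apply: wsum_le => // i.
    by rewrite lef_pV2 ?posrE//; exact: bigmin_le.
  apply: (le_trans h2); rewrite -[leRHS](wsum_cst w1); apply: wsum_le => // i.
  exact: (le_bigmax _ (fun i => a ord0 i)).
- move=> a a0 i; apply: cvg_of_bounds => // j.
  case: (unliftP ord_max j) => [k ->|->].
    by rewrite bary_lift mxE eqxx/= (inj_eq lift_inj).
  rewrite bary_max (bigD1 i)//= mxE !eqxx/= big1 ?addr0 ?subrr ?(negbTE (neq_lift _ _))//.
  by move=> k /negbTE ki; rewrite mxE ki andbF.
- move=> a a0; apply: cvg_of_bounds => // j.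
  case: (unliftP ord_max j) => [k ->|->].
    by rewrite bary_lift mxE eq_sym (negbTE (neq_lift _ _)).
  by rewrite bary_max eqxx big1 ?subr0// => k _; rewrite mxE.
- move=> l hl i; have h := @cvg_derive_of_bounds l i hl.
  by split; [apply/cvg_ex; eexists; exact: h|exact/cvg_lim].
Qed.

End mean_of_bounds.

(** * Symmetry at the barycenter *)

(** Adjacent transpositions generate all permutations: the head of [s] is carried to its place in
    [s'], then removed. *)
Lemma perm_eq_adjacent (T : eqType) (U : Type) (G : seq T -> U) :
  (forall s1 x y s2, G (s1 ++ x :: y :: s2) = G (s1 ++ y :: x :: s2)) ->
  forall s s', perm_eq s s' -> G s = G s'.
Proof.
move=> Gsw.
have move_in s0 x s1 s2 : G (s0 ++ x :: s1 ++ s2) = G (s0 ++ s1 ++ x :: s2).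
  elim: s1 s0 => //= y s1 IHs s0; rewrite Gsw.
  by have := IHs (rcons s0 y); rewrite !cat_rcons.
suff H s0 s s' : perm_eq s s' -> G (s0 ++ s) = G (s0 ++ s').
  by move=> s s'; exact: (H [::]).
elim: s s0 s' => [|x s IHs] s0 s' ss'.
  by move: ss'; rewrite perm_sym => /perm_nilP ->.
have : x \in s' by rewrite -(perm_mem ss') mem_head.
move=> /path.splitPr E; case: E ss' => s1 s2.
rewrite perm_sym -(cat1s x s2) perm_catCA /= perm_cons perm_sym => ss'.
rewrite -move_in; have := IHs (rcons s0 x) _ ss'.
by rewrite !cat_rcons.
Qed.

Section simplex_symmetry.
Context {R : realType} (h : R -> R).
Hypotheses (h0 : forall x, 0 <= h x) (mh : measurable_fun [set: R] h).
Local Notation mu := (@lebesgue_measure R).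
Local Notation T := (measurableTypeR R).

(* The integral of h (c + b_0 t_0 + ... + b_n t_n) over the t >= 0 of sum r,
   one coordinate at a time; the empty list is a junk case. *)
Fixpoint simplex_integral (b : seq R) (c r : R) : \bar R :=
  if b is b0 :: b' then
    if b' is [::] then (h (c + r * b0))%:E
    else (\int[mu]_(x in `[0%R, r]) simplex_integral b' (c + x * b0)%R (r - x)%R)%E
  else 0%E.

Lemma simplex_integral_cons b0 b c r : b != [::] ->
  simplex_integral (b0 :: b) c r =
  (\int[mu]_(x in `[0%R, r]) simplex_integral b (c + x * b0)%R (r - x)%R)%E.
Proof. by case: b. Qed.

(** Moves the bounds into the integrand, so that Tonelli's theorem applies although they depend on
    [r]. *)
Lemma simplex_integral_consT b0 b c r : b != [::] ->
  simplex_integral (b0 :: b) c r =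
  (\int[mu]_x if (0 <= x <= r)%R then simplex_integral b (c + x * b0)%R (r - x)%R else 0)%E.
Proof.
move=> bN; rewrite simplex_integral_cons// integral_mkcond; apply: eq_integral => x _.
by rewrite patchE mem_setE in_itv.
Qed.

Lemma simplex_integral_ge0 b c r : (0 <= simplex_integral b c r)%E.
Proof.
elim: b c r => // b0 b IHb c r; have [->/=|bN] := eqVneq b [::].
  by rewrite lee_fin.
by rewrite simplex_integral_cons//; apply: integral_ge0.
Qed.

(** Joint measurability in (c, r) is required because both arguments move with the integration
    variable. *)
Lemma measurable_simplex_integral b : measurable_fun [set: R * R] (fun z => simplex_integral b z.1 z.2).
Proof.
elim: b => [|b0 b IHb]; first exact: measurable_cst.
have [->/=|bN] := eqVneq b [::].
  apply/measurable_EFinP; apply: measurableT_comp => //.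
  by apply: measurable_funD => //; exact: measurable_funM.
under eq_fun do rewrite simplex_integral_consT//.
pose F (w : (R * R) * R) := (if (0 <= w.2 <= w.1.2)%R
  then simplex_integral b (w.1.1 + w.2 * b0)%R (w.1.2 - w.2)%R else 0)%E.
have F0 w : (0 <= F w)%E by rewrite /F; case: ifP => // _; exact: simplex_integral_ge0.
have m11 : measurable_fun [set: (R * R) * R] (fun w => w.1.1).
  exact: measurableT_comp.
have m12 : measurable_fun [set: (R * R) * R] (fun w => w.1.2).
  exact: measurableT_comp.
have m2 : measurable_fun [set: (R * R) * R] (fun w => w.2) by exact: measurable_snd.
have mF : measurable_fun [set: (R * R) * R] F.
  apply: measurable_fun_ifT => //.
    by apply: measurable_and; exact: measurable_fun_ler.
  apply: (measurableT_comp IHb (g := fun w : (R * R) * R =>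
    (w.1.1 + w.2 * b0, w.1.2 - w.2))).
  apply/measurable_fun_pairP; split => /=.
    by apply: measurable_funD => //; exact: measurable_funM.
  exact: measurable_funB.
exact: (@measurable_fun_fubini_tonelli_F _ _ _ _ _ mu F mF F0).
Qed.

(** If these are the last two coefficients, u and r - u exchange roles; otherwise both sides are
    iterated integrals of the same function [G]. *)
Lemma simplex_integral_swap x y s c r : simplex_integral (x :: y :: s) c r = simplex_integral (y :: x :: s) c r.
Proof.
have [->|sN] := eqVneq s [::].
  rewrite !simplex_integral_consT//=.
  rewrite -[LHS](ge0_integral_reflect r).
  - apply: eq_integral => u _; rewrite subr_ge0 gerDl oppr_le0 andbC.
    by case: ifP => // _; congr (h _)%:E; ring.
  - apply: measurable_fun_ifT => //.
      by apply: measurable_and; exact: measurable_fun_ler.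
    apply/measurable_EFinP; apply: measurableT_comp => //.
    apply: measurable_funD; first by apply: measurable_funD => //; exact: measurable_funM.
    by apply: measurable_funM => //; exact: measurable_funB.
  - by move=> u; case: ifP => // _; rewrite lee_fin.
(* The integrand extended by 0 outside the triangle u, v >= 0, u + v <= r. *)
pose G (w : R * R) := (if (0 <= w.1)%R && ((0 <= w.2)%R && (w.1 + w.2 <= r)%R)
  then simplex_integral s (c + w.1 * x + w.2 * y)%R (r - w.1 - w.2)%R else 0)%E.
have G0 w : (0 <= G w)%E by rewrite /G; case: ifP => // _; exact: simplex_integral_ge0.
have mG : measurable_fun [set: R * R] G.
  apply: measurable_fun_ifT => //.
    apply: measurable_and; first exact: measurable_fun_ler.
    apply: measurable_and; first exact: measurable_fun_ler.
    by apply: measurable_fun_ler => //; exact: measurable_funD.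
  apply: (measurableT_comp (measurable_simplex_integral s) (g := fun w : R * R =>
    (c + w.1 * x + w.2 * y, r - w.1 - w.2))).
  apply/measurable_fun_pairP; split => /=.
    apply: measurable_funD; last exact: measurable_funM.
    by apply: measurable_funD => //; exact: measurable_funM.
  by apply: measurable_funB => //; exact: measurable_funB.
transitivity (\int[mu]_u \int[mu]_v G (u, v))%E.
  rewrite simplex_integral_consT//; apply: eq_integral => u _.
  have [/andP[u0 ur]|ur] := ifP.
    rewrite simplex_integral_consT//; apply: eq_integral => v _.
    by rewrite /G/= u0/= lerBrDl.
  rewrite integral0_eq// => v _; rewrite /G/=; case: ifP => // /and3P[u0 v0 uvr].
  by move: ur; rewrite u0/= (le_trans _ uvr)// lerDl.
rewrite fubini_tonelli//.
rewrite simplex_integral_consT//; apply: eq_integral => v _.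
have [/andP[v0 vr]|vr] := ifP.
  rewrite simplex_integral_consT//; apply: eq_integral => u _.
  rewrite /G/= v0/= lerBrDr; case: ifP => // _.
  by congr (simplex_integral s _ _); ring.
rewrite integral0_eq// => u _; rewrite /G/=; case: ifP => // /and3P[u0 v0 uvr].
by move: vr; rewrite v0/= (le_trans _ uvr)// lerDr.
Qed.

Lemma simplex_integral_perm s s' : perm_eq s s' -> simplex_integral s = simplex_integral s'.
Proof.
apply: perm_eq_adjacent => s1 x y s2; apply/funext => c; apply/funext => r.
elim: s1 c r => [|z s1 IHs] c r; first exact: simplex_integral_swap.
rewrite !cat_cons !simplex_integral_cons; last 2 first.
- by case: s1 {IHs}.
- by case: s1 {IHs}.
by apply: eq_integral => u _.
Qed.

(** Induction on [n]: fixing the first coordinate u replaces [c] by c + u b_0 and [r] by r - u. *)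
Lemma integral_scaled_simplexE n (b : 'I_n.+1 -> R) (c r : R) : 0 <= r ->
  (\int[lebesgue_tuple R n]_(t in scaled_simplex r)
     (h (c + (\sum_(j < n) tnth t j * b (lift ord_max j) +
             (r - \sum_(j < n) tnth t j) * b ord_max)))%:E =
   simplex_integral [seq b i | i <- enum 'I_n.+1] c r)%E.
Proof.
have mt m j : measurable_fun [set: m.-tuple T]
    (fun t => tnth t j : R) by exact: measurable_tnth.
have mF m (b' : 'I_m.+1 -> R) c' r' : measurable_fun [set: m.-tuple T]
    (fun t => (h (c' + (\sum_(j < m) tnth t j * b' (lift ord_max j) +
             (r' - \sum_(j < m) tnth t j) * b' ord_max)))%:E).
  apply/measurable_EFinP; apply: measurableT_comp => //.
  apply: measurable_funD => //; apply: measurable_funD.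
    by apply: measurable_sum => i; apply: measurable_funM => //; exact: mt.
  apply: measurable_funM => //; apply: measurable_funB => //.
  by apply: measurable_sum => i; exact: mt.
elim: n b c r => [|n IHn] b c r r0.
  rewrite scaled_simplex0// ge0_integral_lebesgue_tuple0; last 2 first.
  - exact: mF.
  - by move=> t; rewrite lee_fin.
  rewrite enum_ordSl enum_ord0/= !big_ord0 add0r subr0.
  by rewrite (_ : ord_max = ord0)//; exact/val_inj.
rewrite ge0_integral_scaled_simplexS; last 2 first.
- exact: mF.
- by move=> t; rewrite lee_fin.
rewrite enum_ordSl map_cons -map_comp simplex_integral_cons; last by rewrite enum_ordSl.
apply: eq_integral => u /set_mem; rewrite /= in_itv/= => /andP[u0 ur].
rewrite -IHn ?subr_ge0//; apply: eq_integral => t _; congr (h _)%:E.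
rewrite big_ord_recl [X in r - X]big_ord_recl/=.
have -> : lift ord_max (ord0 : 'I_n.+1) = ord0 by exact/val_inj.
have -> : lift ord0 (ord_max : 'I_n.+1) = ord_max by exact/val_inj.
have e1 : \sum_(i < n) tnth (tuple_cons (u, t)) (lift ord0 i) = \sum_(i < n) tnth t i.
  by apply: eq_bigr => i _; rewrite tnthS.
have e2 : \sum_(i < n) tnth (tuple_cons (u, t)) (lift ord0 i) *
    b (lift ord_max (lift ord0 i)) =
    \sum_(i < n) tnth t i * b (lift ord0 (lift ord_max i)).
  apply: eq_bigr => i _; rewrite tnthS; congr (_ * b _).
  by apply/val_inj; rewrite /= /bump !leq0n !add1n ltnS addnS.
rewrite e1 e2 -[tnth (tuple_cons (u, t)) ord0]/u.
set S1 := \sum_(i < n) _ * _; set S2 := \sum_(i < n) _.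
by ring.
Qed.

End simplex_symmetry.

(** * Symmetry of the two families *)

Section barycenter_symmetry.
Context {R : realType} (n : nat).
Hypothesis hn : (1 <= n)%N.
Local Notation T := (measurableTypeR R).
Local Notation e := (const_mx (n.+1%:R^-1) : 'rV[R]_n).

Let sum_e : \sum_(i < n) e ord0 i = n%:R / n.+1%:R.
Proof.
by under eq_bigr do rewrite mxE; rewrite sumr_const card_ord mulr_natl.
Qed.

Lemma int_En_barycenter : int_En e.
Proof.
split=> [i|]; first by rewrite mxE invr_gt0 ltr0n.
by rewrite sum_e ltr_pdivrMr ?ltr0n// mul1r ltr_nat.
Qed.

(** Every [alpha] is 1 here, so all exponents are 0, and [powR] with exponent 0 is 1 even at 0. *)
Lemma density_barycenter (t : n.-tuple T) :
  density_lambda e t = n%:R / multi_beta (fun _ : 'I_n => 1).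
Proof.
have aE i : (alpha e i)^-1 = 1.
  rewrite /alpha bary_max sum_e mxE.
  have n0 : n.+1%:R != 0 :> R by rewrite pnatr_eq0.
  have -> : 1 - n%:R / n.+1%:R = n.+1%:R^-1 :> R by rewrite -natr1; field; rewrite natr1.
  by rewrite divff ?invr1// invr_eq0.
rewrite /density_lambda; under eq_bigr do rewrite aE.
rewrite sumr_const card_ord.
have -> : (fun i : 'I_n => (alpha e i)^-1) = fun=> 1 by apply/funext => i; rewrite aE.
by rewrite big1 ?mulr1// => i _; rewrite aE subrr powRr0.
Qed.

(** The constant density factors out, leaving a [simplex_integral], which depends on the list of
    coefficients only up to permutation. *)
Lemma integral_barycenter_perm (h : R -> R) (b : 'I_n.+1 -> R) (s : {perm 'I_n.+1}) :
  (forall x, 0 <= h x) -> measurable_fun [set: R] h ->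
  \int[mu_lambda e]_(t in @En R n) h (\sum_(i < n.+1) bary (tnth t) i * b (s i)) =
  \int[mu_lambda e]_(t in @En R n) h (\sum_(i < n.+1) bary (tnth t) i * b i).
Proof.
move=> h0 mh; have he := int_En_barycenter.
have K b' : (\int[mu_lambda e]_(t in @En R n)
    (h (\sum_(i < n.+1) bary (tnth t) i * b' i))%:E =
    simplex_integral h [seq b' i | i <- enum 'I_n.+1] 0 1 *
      (n%:R / multi_beta (fun _ : 'I_n => 1))%:E)%E.
  have mF : measurable_fun (@En R n)
      (fun t : n.-tuple T => (h (\sum_(i < n.+1) bary (tnth t) i * b' i))%:E).
    apply: measurable_funTS; apply/measurable_EFinP.
    by apply: measurableT_comp => //; exact: measurable_sum_bary.
  rewrite ge0_integral_mu_lambda//; last by move=> t _; rewrite lee_fin.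
  under eq_integral do rewrite density_barycenter.
  rewrite ge0_integralZr//; last 3 first.
  - exact: measurable_En.
  - by move=> t _; rewrite lee_fin.
  - rewrite lee_fin !divr_ge0 ?Gamma_ge0 ?ler0n//.
    by apply: prodr_ge0 => i _; exact: Gamma_ge0.
  congr (_ * _)%E; rewrite -integral_scaled_simplexE// EnE.
  by apply: eq_integral => t _; rewrite sum_bary add0r.
rewrite /Rintegral; congr fine.
rewrite (K (fun i => b (s i))) K; congr (_ * _)%E.
rewrite (@simplex_integral_perm _ h h0 mh _ [seq b i | i <- enum 'I_n.+1])//.
rewrite (map_comp b s); apply: perm_map; apply: uniq_perm.
- by rewrite map_inj_uniq ?enum_uniq//; exact: perm_inj.
- exact: enum_uniq.
- move=> i; rewrite mem_enum; apply/mapP; exists (s^-1%g i); rewrite ?mem_enum//.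
  by rewrite permKV.
Qed.

Lemma calL_sym (a : 'rV[R]_n.+1) (s : {perm 'I_n.+1}) : pos_orthant a ->
  calL e (col_perm s a) = calL e a.
Proof.
move=> a0; rewrite !calL_expR//; last by move=> i; rewrite mxE.
rewrite -(integral_barycenter_perm (fun i => ln (a ord0 i)) s); last 2 first.
- exact: expR_ge0.
- exact: measurable_expR.
apply: eq_Rintegral => t _; congr expR.
by apply: eq_bigr => i _; rewrite mxE.
Qed.

Lemma bbL_sym (a : 'rV[R]_n.+1) (s : {perm 'I_n.+1}) : pos_orthant a ->
  bbL e (col_perm s a) = bbL e a.
Proof.
move=> a0; rewrite !bbL_expR//; last by move=> i; rewrite mxE.
congr (_^-1).
rewrite -(@integral_barycenter_perm (fun y => expR (- ln y)) (a ord0) s); last 2 first.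
- by move=> y; exact: expR_ge0.
- apply: (measurableT_comp (@measurable_expR R)).
  by apply: (measurableT_comp (@oppr_measurable R setT)); exact: measurable_ln.
apply: eq_Rintegral => t _; congr (expR (- ln _)).
by apply: eq_bigr => i _; rewrite mxE.
Qed.

End barycenter_symmetry.

Theorem proposition4p1 (R : realType) (n : nat) (hn : (1 <= n)%N) :
  weighted_multivariate_mean (@calL R n) /\
  weighted_multivariate_mean (@bbL R n).
Proof.
split; apply: weighted_mean_of_bounds.
- exact: calL_bounds.
- by move=> a a0 s; exact: calL_sym.
- exact: bbL_bounds.
- by move=> a a0 s; exact: bbL_sym.
Qed.
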